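(* Let $h=0$, $\mu>0$ and $\rho=\frac1{2\mu}$. Then for all $\beta<\frac{2\mu}J$, \[ w_2(\mu_{\mathrm{GC}}^{\beta,\mu;N},\mu_{\mathrm{MC}}^{0,\rho;N};N)^2\le\frac1N\frac1{2(\mu-\frac{\beta J}2)}+\frac1N\frac1\mu=\frac1N\left(\frac\rho{1-\rho\beta J}+2\rho\right), \] so that $w_2(\mu_{\mathrm{GC}}^{\beta,\mu;N},\mu_{\mathrm{MC}}^{0,\rho;N};N)=O(N^{-1/2})$.
   Context: Mean-field spherical model with $h=0$: $\phi\in\mathbb{R}^N$, $J>0$, $H[\phi]=-\frac J{2N}(\sum_x\phi_x)^2$, $N[\phi]=\sum_x\phi_x^2$. The grand canonical ensemble $\mu_{\mathrm{GC}}^{\beta,\mu;N}$ ($\mu>0$, $\beta<2\mu/J$) is the probability measure on $\mathbb{R}^N$ with density proportional to $e^{-\beta H[\phi]-\mu N[\phi]}$. The microcanonical ensemble at energy density $0$, $\mu_{\mathrm{MC}}^{0,\rho;N}$, is the normalized uniform surface measure on $\{\sum_x\phi_x=0,\ \sum_x\phi_x^2=\rho N\}$. $w_2(\mu_1,\mu_2;N)=\left(\inf_\gamma\int\gamma(dx,dy)\frac1N\sum_i|x_i-y_i|^2\right)^{1/2}$ over couplings. *)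

(* Defs.v *)
(* R : realType, R^N represented as N.-tuple R
   with its product (= Borel) sigma-algebra from measurable_structure.v. *)
From HB Require Import structures.
From mathcomp Require Import all_boot all_order all_algebra.
From mathcomp Require Import all_classical all_reals all_analysis.
Set Implicit Arguments. Unset Strict Implicit. Unset Printing Implicit Defensive.
Import Order.TTheory GRing.Theory Num.Theory.
Local Open Scope classical_set_scope.
Local Open Scope ring_scope.

Section Defs.
Variable R : realType.

Definition tsum (N : nat) (x : N.-tuple R) : R := \sum_(i < N) tnth x i.
Definition tsumsq (N : nat) (x : N.-tuple R) : R := \sum_(i < N) tnth x i ^+ 2.

(* Hamiltonian of the mean-field spherical model with h = 0 *)
Definition Ham (J : R) (N : nat) (x : N.-tuple R) : R :=
  - (J / (N%:R *+ 2)) * (tsum x) ^+ 2.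

(* Lebesgue integral on R^n of a function with values in \bar R, written as
   the iterated integral over the coordinates (Tonelli) *)
Fixpoint lebN (n : nat) : (n.-tuple R -> \bar R) -> \bar R :=
  match n with
  | 0 => fun f => f [tuple]
  | n'.+1 => fun f =>
      (\int[@lebesgue_measure R]_x lebN (fun t : n'.-tuple R => f [tuple of x :: t]))%E
  end.

Definition gc_weight (beta mu J : R) (N : nat) (x : N.-tuple R) : R :=
  expR (- beta * Ham J x - mu * tsumsq x).

Definition is_GC (beta mu J : R) (N : nat) (P : probability (N.-tuple R) R) :=
  forall A : set (N.-tuple R), measurable A ->
    (P A * @lebN N (fun x => (gc_weight beta mu J x)%:E)
     = @lebN N (fun x => (\1_A x * gc_weight beta mu J x)%:E))%E.

Definition mxact (N : nat) (Q : 'M[R]_N) (x : N.-tuple R) : N.-tuple R :=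
  [tuple \sum_(j < N) Q i j * tnth x j | i < N].

(* orthogonal transformations of R^N fixing (1,...,1): these are exactly the
   isometries of the hyperplane {sum = 0} extended to R^N, and they act
   transitively on the microcanonical sphere *)
Definition orth_fix1 (N : nat) (Q : 'M[R]_N) : Prop :=
  Q *m Q^T = 1%:M /\ forall i : 'I_N, \sum_(j < N) Q i j = 1.

(* the microcanonical surface at energy density 0 (H = 0 iff sum = 0) *)
Definition mc_surface (N : nat) (rho : R) : set (N.-tuple R) :=
  [set x | tsum x = 0 /\ tsumsq x = rho * N%:R].

(* P is the normalized uniform surface measure on mc_surface: the (unique)
   probability measure concentrated on the surface and invariant under its
   symmetry group. *)
Definition is_MC (rho : R) (N : nat) (P : probability (N.-tuple R) R) :=
  P (@mc_surface N rho) = 1%E /\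
  forall Q : 'M[R]_N, orth_fix1 Q ->
    forall A : set (N.-tuple R), measurable A -> P (mxact Q @^-1` A) = P A.

Definition is_coupling (N : nat) (P1 P2 : probability (N.-tuple R) R)
    (G : probability (N.-tuple R * N.-tuple R)%type R) :=
  (forall A : set (N.-tuple R), measurable A -> G (fst @^-1` A) = P1 A) /\
  (forall A : set (N.-tuple R), measurable A -> G (snd @^-1` A) = P2 A).

Definition cost (N : nat) (z : (N.-tuple R * N.-tuple R)%type) : R :=
  N%:R^-1 * \sum_(i < N) (tnth z.1 i - tnth z.2 i) ^+ 2.

Definition w2sq (N : nat) (P1 P2 : probability (N.-tuple R) R) : \bar R :=
  ereal_inf [set (\int[G]_z (cost z)%:E)%E
            | G in [set G | @is_coupling N P1 P2 G]].

End Defs.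

(* Main.v *)
(* Split a field into its mean and its fluctuation around the mean. Under the
   grand canonical measure the normalized mean s and the squared norm r^2 of the
   fluctuation are those of independent Gaussians, and the measure is invariant
   under the orthogonal maps fixing (1,...,1). Hence rescaling the fluctuation to
   the radius sqrt A, where A = N / (2 mu), gives a random field with the
   microcanonical law, and this coupling costs
     (s^2 + (r - sqrt A)^2) / N <= (s^2 + (r^2 - A)^2 / A) / N,
   whose expectation is a combination of second and fourth Gaussian moments.

   Rotation invariance of Lebesgue measure and uniqueness of the invariant
   probability on the sphere both come from one principle (Christensen): two
   measures carried by a set S for which every ball centred in S has the same
   finite positive measure, depending on the radius only, are equal. *)
Require Import Defs.
From HB Require Import structures.
From mathcomp Require Import all_boot all_order all_algebra.
From mathcomp Require Import all_classical all_reals all_analysis.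
From mathcomp Require Import measurable_realfun ring lra.
Set Implicit Arguments. Unset Strict Implicit. Unset Printing Implicit Defensive.
Import Order.TTheory GRing.Theory Num.Theory.
Import numFieldNormedType.Exports.
Local Open Scope classical_set_scope.
Local Open Scope ring_scope.

(** * Lebesgue measure on tuples *)

Section image_measure.
Context d d' (T1 : measurableType d) (T2 : measurableType d') (R : realType).
Variables (m : {measure set T1 -> \bar R}) (f : T1 -> T2).
Hypothesis mf : measurable_fun setT f.

Definition pushm of measurable_fun setT f := pushforward m f.

Let pushmm := measure_function_pushforward__canonical__measure_function_Measure m mf.
Let pushm0 : pushm mf set0 = 0%E. Proof. exact: (@measure0 _ _ _ pushmm). Qed.
Let pushm_ge0 A : (0 <= pushm mf A)%E. Proof. exact: (@measure_ge0 _ _ _ pushmm). Qed.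
Let pushm_sigma_additive : semi_sigma_additive (pushm mf).
Proof. exact: (@measure_semi_sigma_additive _ _ _ pushmm). Qed.

HB.instance Definition _ := isMeasure.Build _ _ _ (pushm mf)
  pushm0 pushm_ge0 pushm_sigma_additive.

Lemma ge0_integral_pushm (g : T2 -> \bar R) :
  measurable_fun setT g -> (forall y, 0 <= g y)%E ->
  (\int[pushm mf]_y g y = \int[m]_x g (f x))%E.
Proof.
by move=> mg g0; rewrite /pushm ge0_integral_pushforward.
Qed.

End image_measure.

Section image_probability.
Context d d' (T1 : measurableType d) (T2 : measurableType d') (R : realType).
Variables (P : probability T1 R) (f : T1 -> T2).
Hypothesis mf : measurable_fun setT f.

Definition pushp (H : measurable_fun setT f) := pushm P H.
HB.instance Definition _ := Measure.on (pushp mf).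
Let pushp_setT : pushp mf setT = 1%E.
Proof. exact: (probability_setT P). Qed.
HB.instance Definition _ := Measure_isProbability.Build _ _ _ (pushp mf) pushp_setT.

End image_probability.

Section cons_measure.
Variables (R : realType) (n : nat).
Variable m : {sigma_finite_measure set (n.-tuple R) -> \bar R}.

Definition tcons (z : measurableTypeR R * n.-tuple R) : n.+1.-tuple R := [tuple of z.1 :: z.2].
Definition tuncons (x : n.+1.-tuple R) : measurableTypeR R * n.-tuple R :=
  (thead x, [tuple of behead x]).

Lemma tconsK : cancel tcons tuncons.
Proof. by move=> [x t]; congr pair; rewrite ?theadE//; apply: val_inj. Qed.

Lemma measurable_tcons : measurable_fun setT tcons.
Proof. exact: (measurable_cons (f := fst) (g := snd)). Qed.

Lemma measurable_tuncons : measurable_fun setT tuncons.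
Proof.
apply: measurable_fun_pair; first exact: measurable_tnth.
exact: measurable_behead.
Qed.

Definition consm : set (n.+1.-tuple R) -> \bar R :=
  pushm (product_measure1 (@lebesgue_measure R) m) measurable_tcons.

HB.instance Definition _ := Measure.on consm.

Let consm_sigma_finite : sigma_finite setT consm.
Proof.
have /sigma_finiteP[F [FT ndF Foo]] := sigma_finiteT (@lebesgue_measure R).
have /sigma_finiteP[G [GT ndG Goo]] := sigma_finiteT m.
exists (fun k => tuncons @^-1` (F k `*` G k)).
  apply/esym; rewrite -subTset => x _.
  have : (\bigcup_i F i) (thead x) by rewrite -FT.
  have : (\bigcup_i G i) [tuple of behead x] by rewrite -GT.
  move=> [k _ Gk] [l _ Fl]; exists (maxn k l) => //; split => /=.
    by move: Fl; exact/subsetPset/ndF/leq_maxr.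
  by move: Gk; exact/subsetPset/ndG/leq_maxl.
move=> k; have [mF Fk] := Foo k; have [mG Gk] := Goo k; split.
  rewrite -[X in measurable X]setTI; apply: measurable_tuncons => //.
  exact: measurableX.
rewrite /consm /pushm /pushforward -comp_preimage.
rewrite (_ : tuncons \o tcons = id); last by apply/funext => x; exact: tconsK.
have : (product_measure1 (@lebesgue_measure R) m (F k `*` G k) < +oo)%E.
  by rewrite product_measure1E// lte_mul_pinfty// ge0_fin_numE.
by [].
Qed.

HB.instance Definition _ := Measure_isSigmaFinite.Build _ _ _ consm consm_sigma_finite.

Lemma ge0_integral_consm (f : n.+1.-tuple R -> \bar R) :
  measurable_fun setT f -> (forall x, 0 <= f x)%E ->
  (\int[consm]_x f x =
   \int[@lebesgue_measure R]_x \int[m]_t f [tuple of x :: t])%E.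
Proof.
move=> mf f0.
rewrite /consm ge0_integral_pushm// fubini_tonelli1//.
exact: measurableT_comp measurable_tcons.
Qed.

End cons_measure.

Fixpoint lebM (R : realType) (n : nat) : {sigma_finite_measure set (n.-tuple R) -> \bar R} :=
  match n with
  | 0 => \d_ ([tuple] : 0.-tuple R)
  | n'.+1 => @consm R n' (lebM R n')
  end.

Lemma integral_lebM (R : realType) (n : nat) (f : n.-tuple R -> \bar R) :
  measurable_fun setT f -> (forall x, 0 <= f x)%E ->
  (\int[lebM R n]_x f x = lebN f)%E.
Proof.
elim: n f => [|n IH] f mf f0 /=.
  rewrite integral_dirac// diracE in_setT mul1e; congr f; exact: val_inj.
rewrite ge0_integral_consm//; apply: eq_integral => x _.
rewrite IH//.
apply: (measurableT_comp mf).
by apply: measurable_cons.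
Qed.

(** * Uniqueness of uniformly distributed measures *)

Section euclidean_balls.
Variables (R : realType) (n : nat).
Implicit Types x y z : n.-tuple R.

Definition sqd x y : R := \sum_(i < n) (tnth x i - tnth y i) ^+ 2.

(* The parameter [r] is the square of the radius. *)
Definition eball x (r : R) : set (n.-tuple R) := [set y | sqd x y < r].

Definition eopen (U : set (n.-tuple R)) :=
  forall x, U x -> exists2 r : R, 0 < r & eball x r `<=` U.

Definition cube (k : nat) : set (n.-tuple R) :=
  [set x | forall i, `|tnth x i| < k%:R].

Lemma sqdC x y : sqd x y = sqd y x.
Proof. by apply: eq_bigr => i _; rewrite -sqrrN opprB. Qed.

Lemma sqd_triangle x y z : sqd x z <= 2 * sqd x y + 2 * sqd y z.
Proof.
rewrite /sqd !mulr_sumr -big_split/=; apply: ler_sum => i _.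
rewrite -subr_ge0 (_ : _ - _ = (tnth x i - tnth y i - (tnth y i - tnth z i)) ^+ 2).
  exact: sqr_ge0.
ring.
Qed.

Lemma sqr_coord_le_sqd x y i : (tnth x i - tnth y i) ^+ 2 <= sqd x y.
Proof.
by rewrite /sqd (bigD1 i)//= lerDl sumr_ge0// => j _; exact: sqr_ge0.
Qed.

Lemma measurable_sublevel d (T : measurableType d) (f : T -> R) (r : R) :
  measurable_fun setT f -> measurable [set x | f x < r].
Proof.
move=> mf; rewrite -[X in measurable X]setTI.
have -> : [set x | f x < r] = f @^-1` `]-oo, r[%classic.
  by apply/seteqP; split => x /=; rewrite in_itv.
exact: mf.
Qed.

Lemma measurable_sqd d (T : measurableType d) (f g : T -> n.-tuple R) :
  measurable_fun setT f -> measurable_fun setT g ->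
  measurable_fun setT (fun t => sqd (f t) (g t)).
Proof.
move=> mf mg; apply: measurable_sum => i; apply: measurable_funX.
apply: measurable_funB.
  exact: (measurableT_comp (@measurable_tnth _ _ n i) mf).
exact: (measurableT_comp (@measurable_tnth _ _ n i) mg).
Qed.

Lemma measurable_eball x r : measurable (eball x r).
Proof. by apply: measurable_sublevel; exact: measurable_sqd. Qed.

Lemma eopenT : eopen setT.
Proof. by move=> x _; exists 1. Qed.

Lemma eopenI U V : eopen U -> eopen V -> eopen (U `&` V).
Proof.
move=> oU oV x [Ux Vx]; have [r r0 rU] := oU x Ux; have [s s0 sV] := oV x Vx.
exists (Num.min r s); first by rewrite lt_min r0.
by move=> y; rewrite /eball/= lt_min => /andP[yr ys]; split; [exact: rU|exact: sV].
Qed.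

Lemma eopen_coord i (U : set R) : open U -> eopen ((fun x => tnth x i) @^-1` U).
Proof.
move=> oU x /= Ux; have /nbhs_ballP[e e0 eU] : nbhs (tnth x i) U by exact: open_nbhs_nbhs.
exists (e ^+ 2); first by rewrite exprn_gt0.
move=> y; rewrite /eball/= => xy; apply: eU.
rewrite /ball/= -(@ltr_pXn2r _ 2)// ?nnegrE ?normr_ge0 ?(ltW e0)//.
by rewrite real_normK ?num_real// (le_lt_trans (sqr_coord_le_sqd _ _ i)).
Qed.

Lemma cubeE k : cube k =
  \big[setI/setT]_(i < n) ((fun x => tnth x i) @^-1` `]-k%:R, k%:R[%classic).
Proof.
rewrite -bigcap_seq; apply/seteqP; split => x /= xk.
  by move=> i _ /=; rewrite in_itv/= -ltr_norml; exact: xk.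
by move=> i; have := xk i (mem_index_enum _); rewrite /= in_itv/= -ltr_norml.
Qed.

Lemma measurable_coord i (U : set R) : measurable U ->
  measurable ((fun x => tnth x i) @^-1` U).
Proof.
by move=> mU; rewrite -[X in measurable X]setTI; exact: measurable_tnth.
Qed.

Lemma measurable_cube k : measurable (cube k).
Proof.
by rewrite cubeE; apply: bigsetI_measurable => i _; exact: measurable_coord.
Qed.

Lemma eopen_cube k : eopen (cube k).
Proof.
rewrite cubeE; apply: (big_ind eopen); [exact: eopenT|exact: eopenI|].
by move=> i _; apply: eopen_coord; exact: interval_open.
Qed.

Lemma bigcup_cube : \bigcup_k cube k = setT.
Proof.
rewrite -subTset => x _.
exists (Num.truncn (\sum_(i < n) `|tnth x i|)).+1 => //= i.
apply: le_lt_trans (truncnS_gt _).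
by rewrite (bigD1 i)//= lerDl sumr_ge0.
Qed.

Lemma eball_sub_cube (r : R) :
  exists k, eball [tuple 0 | i < n] r `<=` cube k.
Proof.
exists (Num.truncn `|r|).+2 => x; rewrite /eball/= => xr i.
apply: (@le_lt_trans _ _ (`|r| + 1)); last first.
  by rewrite -natr1 ltrD2r truncnS_gt.
rewrite -(@ler_pXn2r _ 2)// ?nnegrE ?normr_ge0 ?addr_ge0//.
rewrite real_normK ?num_real// -sqrrN.
have := sqr_coord_le_sqd [tuple 0 | i < n] x i.
rewrite tnth_mktuple sub0r => /le_trans; apply.
apply: (le_trans (ltW xr)); apply: (le_trans (ler_norm _)).
by have := normr_ge0 r; nra.
Qed.

Lemma measurable_eopen_generated :
  @measurable _ (n.-tuple R) = <<s [set U | measurable U /\ eopen U] >>.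
Proof.
apply/seteqP; split; last first.
  by apply: smallest_sub; [exact: sigma_algebra_measurable|move=> U []].
apply: smallest_sub; first exact: smallest_sigma_algebra.
move=> A; rewrite -bigcup_seq => -[i _ [B mB <-]].
rewrite setTI.
pose H := [set C : set R |
  <<s [set U | measurable U /\ eopen U] >> ((fun x => tnth x i) @^-1` C)].
have sH : sigma_algebra setT H.
  have sG := smallest_sigma_algebra setT [set U : set (n.-tuple R) | measurable U /\ eopen U].
  split.
  - by rewrite /H /= preimage_set0; case: sG.
  - move=> C HC; rewrite /H /= setTD preimage_setC -setTD.
    by case: sG => _ + _; exact.
  - move=> F HF; rewrite /H /= preimage_bigcup.
    by case: sG => _ _; exact.
have HG : (@RGenOpens.G R).-sigma.-measurable `<=` H.
  apply: smallest_sub => // _ [a [b ->]]; apply: sub_sigma_algebra; split.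
    by apply: measurable_coord; exact: measurable_itv.
  by apply: eopen_coord; exact: interval_open.
by apply: HG; rewrite -RGenOpens.measurableE.
Qed.

Lemma rational_dense (r : R) x : 0 < r ->
  exists q : n.-tuple rat, sqd (map_tuple ratr q) x < r.
Proof.
move=> r0; pose e := Num.min 1 (r / n.+1%:R).
have e0 : 0 < e by rewrite lt_min ltr01 divr_gt0.
have /choice[q qP] : forall i : 'I_n, exists q : rat, `|ratr q - tnth x i| < e.
  move=> i; have /rat_in_itvoo[q] : tnth x i - e < tnth x i + e by lra.
  rewrite in_itv/= => qi; exists q.
  by rewrite ltr_distl.
exists [tuple q i | i < n].
apply: (@le_lt_trans _ _ (\sum_(i < n) r / n.+1%:R)).
  apply: ler_sum => i _; rewrite tnth_map tnth_mktuple.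
  rewrite -real_normK ?num_real//; apply: (@le_trans _ _ (e ^+ 2)).
    by rewrite ler_pXn2r ?nnegrE// ?(ltW e0)// ltW.
  apply: (@le_trans _ _ e); last by rewrite /e ge_min lexx orbT.
  by rewrite expr2 ger_pMl// /e ge_min lexx.
rewrite sumr_const card_ord -[X in X < _]mulr_natr mulrAC ltr_pdivrMr//.
by rewrite ltr_pM2l// ltr_nat.
Qed.

End euclidean_balls.
Section uniformly_distributed.
Local Open Scope ereal_scope.
Variables (R : realType) (n : nat).
Implicit Types (m : {sigma_finite_measure set (n.-tuple R) -> \bar R}).
Implicit Types (S U V : set (n.-tuple R)).

(* If these balls were null, countably many null balls centred at rational
   points would cover [S]. *)
Lemma uniform_eball_neq0 (m : {measure set (n.-tuple R) -> \bar R}) S (r : R) c :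
  measurable S -> m S != 0 -> (0 < r)%R ->
  (forall x, S x -> m (eball x r) = c) -> c != 0.
Proof.
move=> mS mS0 r0 mc; apply/eqP => c0; move/eqP: mS0; apply.
apply: measure_negligible => //.
pose F k := if unpickle k is Some q
  then S `&` eball (map_tuple ratr (q : n.-tuple rat)) (r / 4)%R else set0.
apply: (@negligibleS _ _ _ _ (\bigcup_k F k)).
  have r4 : (0 < r / 4)%R by rewrite divr_gt0.
  move=> x Sx; have [q qx] := rational_dense x r4.
  by exists (pickle q) => //; rewrite /F pickleK; split.
apply: negligible_bigcup => k; rewrite /F.
case: (unpickle k) => [q|]; last exact: negligible_set0.
have [[s [Ss qs]]|noS] := pselect (exists s, S s /\ eball (map_tuple ratr q) (r / 4)%R s).
  exists (eball s r); split; [exact: measurable_eball|by rewrite mc|].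
  move=> y [_]; rewrite /eball/= in qs * => qy.
  apply: (le_lt_trans (sqd_triangle _ (map_tuple ratr q) _)).
  by rewrite (sqdC s); lra.
exists set0; split => // y [Sy qy]; apply: noS; by exists y.
Qed.

Lemma measurable_fun_eball m V (r : R) : measurable V ->
  measurable_fun setT (fun x => m (V `&` eball x r)).
Proof.
move=> mV; pose E := [set z : n.-tuple R * n.-tuple R | V z.2 /\ (sqd z.1 z.2 < r)%R].
have mE : measurable E.
  have -> : E = (setT `*` V) `&` [set z | (sqd z.1 z.2 < r)%R].
    by apply/seteqP; split => -[x y] /= => [[]|[[]]].
  apply: measurableI; first exact: measurableX.
  by apply: measurable_sublevel; exact: measurable_sqd.
rewrite (_ : (fun _ => _) = m \o xsection E); first exact: measurable_fun_xsection.
by apply/funext => x /=; congr (m _); rewrite xsectionE.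
Qed.

Lemma integral_eball_swap m1 m2 V (r : R) : measurable V ->
  \int[m1]_(x in V) m2 (V `&` eball x r) = \int[m2]_(y in V) m1 (V `&` eball y r).
Proof.
move=> mV; pose E := [set z : n.-tuple R * n.-tuple R |
  [/\ V z.1, V z.2 & (sqd z.1 z.2 < r)%R]].
have mE : measurable E.
  have -> : E = (V `*` V) `&` [set z | (sqd z.1 z.2 < r)%R].
    by apply/seteqP; split => -[x y] /= => [[]|[[]]].
  apply: measurableI; first exact: measurableX.
  by apply: measurable_sublevel; exact: measurable_sqd.
have := @fubini_tonelli _ _ _ _ _ m1 m2 (fun z => (\1_E z)%:E).
move=> H.
rewrite [LHS]integral_mkcond [RHS]integral_mkcond/=.
transitivity (\int[m1]_x \int[m2]_y (\1_E (x, y))%:E).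
  apply: eq_integral => x _; rewrite patchE.
  have mEx : measurable [set y | E (x, y)].
    by have := measurable_xsection x mE; rewrite xsectionE.
  have -> : \int[m2]_y (\1_E (x, y))%:E = m2 [set y | E (x, y)].
    by rewrite -[in RHS](setIT [set y | E (x, y)]) -integral_indic.
  case: ifPn => [|] xV.
    congr (m2 _); apply/seteqP; split => y /=.
      by rewrite /eball/= => -[Vy xy]; split => //; exact: set_mem.
    by move=> [].
  rewrite (_ : [set y | _] = set0) ?measure0//.
  apply/seteqP; split => y //= -[/= Vx _ _].
  by move/negP: xV; apply; exact: mem_set.
rewrite H; last 2 first.
- by apply/measurable_EFinP.
- by move=> z; rewrite lee_fin.
apply/esym; apply: eq_integral => y _; rewrite patchE.
have mEy : measurable [set x | E (x, y)].
  by have := measurable_ysection y mE; rewrite ysectionE.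
have -> : \int[m1]_x (\1_E (x, y))%:E = m1 [set x | E (x, y)].
  by rewrite -[in RHS](setIT [set x | E (x, y)]) -integral_indic.
case: ifPn => [|] yV.
  congr (m1 _); apply/seteqP; split => x /=.
    by rewrite /eball/= => -[Vx xy]; split => //; [exact: set_mem|rewrite sqdC].
  by rewrite /eball/= => -[? ?]; rewrite sqdC.
rewrite (_ : [set x | _] = set0) ?measure0//.
apply/seteqP; split => x //= -[/= _ Vy _].
by move/negP: yV; apply; exact: mem_set.
Qed.

Lemma measure_setI_conull (m : {measure set (n.-tuple R) -> \bar R}) S A :
  measurable S -> m (~` S) = 0 -> measurable A -> m (S `&` A) = m A.
Proof.
move=> mS S0 mA; rewrite -[in RHS](setIT A) -(setUv S) setIUr measureU//.
- rewrite setIC [X in _ = _ + X](_ : _ = 0) ?adde0//.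
  apply/eqP; rewrite -measure_le0 -S0 le_measure ?inE//.
    by apply: measurableI => //; exact: measurableC.
  exact: measurableC.
- exact: measurableI.
- by apply: measurableI => //; exact: measurableC.
- by rewrite setIACA setICr setI0.
Qed.

Lemma uniform_eball_swap m1 m2 S (r : R) c1 c2 : measurable S ->
  m1 (~` S) = 0 -> m2 (~` S) = 0 ->
  (forall x, S x -> m1 (eball x r) = c1) ->
  (forall x, S x -> m2 (eball x r) = c2) ->
  c2 * m1 S = c1 * m2 S.
Proof.
move=> mS S1 S2 m1c m2c.
have := @integral_eball_swap m1 m2 S r mS.
rewrite (eq_integral (cst c2)) => [|x /set_mem Sx]; last first.
  by rewrite measure_setI_conull//; [exact: m2c|exact: measurable_eball].
rewrite [RHS](eq_integral (cst c1)) => [|x /set_mem Sx]; last first.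
  by rewrite measure_setI_conull//; [exact: m1c|exact: measurable_eball].
by rewrite !integral_cst.
Qed.

(* For [x] in the open set [U], a small enough ball around [x] lies in [U], so that
   [m2 (U `&` eball x r) / h r] tends to [1]; Fatou's lemma and
   [integral_eball_swap] then compare [m1 U] and [m2 U]. *)
Lemma uniform_measure_le m1 m2 S (h : R -> R) :
  measurable S -> m1 (~` S) = 0 -> m2 (~` S) = 0 ->
  (forall r, 0 < r -> 0 < h r)%R ->
  (forall x r, S x -> (0 < r)%R -> m1 (eball x r) = (h r)%:E) ->
  (forall x r, S x -> (0 < r)%R -> m2 (eball x r) = (h r)%:E) ->
  forall U, measurable U -> eopen U -> m1 U <= m2 U.
Proof.
move=> mS S1 S2 h0 m1h m2h U mU oU.
rewrite -(measure_setI_conull mS S1 mU) -(measure_setI_conull mS S2 mU).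
set V := S `&` U; have mV : measurable V by exact: measurableI.
pose r (k : nat) : R := (k.+1%:R^-1)%R.
have r0 k : (0 < r k)%R by rewrite invr_gt0.
pose f k x := (h (r k))^-1%:E * m2 (V `&` eball x (r k)).
have f0 k x : 0 <= f k x.
  by apply: mule_ge0 => //; rewrite lee_fin invr_ge0 ltW// h0.
have mf k : measurable_fun setT (f k).
  apply: measurable_funeM.
  exact: measurable_fun_eball.
have fV : forall k, \int[m1]_(x in V) f k x <= m2 V.
  move=> k; rewrite ge0_integralZl_EFin//; last 2 first.
  - apply: measurable_funTS.
    exact: measurable_fun_eball.
  - by rewrite invr_ge0 ltW// h0.
  rewrite integral_eball_swap//.
  apply: (@le_trans _ _ ((h (r k))^-1%:E * \int[m2]_(y in V) (h (r k))%:E)).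
    rewrite lee_pmul2l ?fin_numE// ?lte_fin ?invr_gt0 ?h0//.
    apply: ge0_le_integral => //.
    + by apply: measurable_funTS; exact: measurable_fun_eball.
    + move=> x [Sx _]; rewrite -(m1h x)// le_measure ?inE//.
      * by apply: measurableI => //; exact: measurable_eball.
      * exact: measurable_eball.
  by rewrite integral_cst// muleA -EFinM mulVf ?mul1e// gt_eqF// h0.
have f1 x : V x -> limn_einf (f ^~ x) = 1.
  move=> [Sx Ux]; suff /cvg_limn_einf_sup[->] : f ^~ x @ \oo --> 1 by [].
  have [s s0 sU] := oU x Ux.
  apply: cvg_near_cst; near=> k.
  have rs : (r k <= s)%R by apply: ltW; near: k; exact: near_infty_natSinv_lt (PosNum s0).
  rewrite /f /V -setIA measure_setI_conull//; last first.
    by apply: measurableI => //; exact: measurable_eball.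
  rewrite setIidr; last by move=> y xy; apply: sU; exact: lt_le_trans xy rs.
  by rewrite [X in _ * X](m2h x (r k) Sx (r0 k)) -EFinM mulVf// gt_eqF// h0.
have := @fatou _ _ _ m1 V mV f (fun k => measurable_funTS (mf k)) (fun k x _ => f0 k x).
rewrite (eq_integral (cst 1)) => [|x /set_mem Vx]; last by rewrite f1.
rewrite integral_cst// mul1e => /le_trans; apply.
rewrite limn_einf_lim; apply: lime_le; first exact: is_cvg_einfs.
apply: nearW => k; apply: (le_trans _ (fV k)).
by apply: ereal_inf_lbound; exists k => /=.
Unshelve. all: by end_near. Qed.

Lemma uniform_measure_unique m1 m2 S (h : R -> R) :
  measurable S -> m1 (~` S) = 0 -> m2 (~` S) = 0 ->
  (forall r, 0 < r -> 0 < h r)%R ->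
  (forall x r, S x -> (0 < r)%R -> m1 (eball x r) = (h r)%:E) ->
  (forall x r, S x -> (0 < r)%R -> m2 (eball x r) = (h r)%:E) ->
  (forall k, m1 (@cube R n k) < +oo) ->
  forall A, measurable A -> m1 A = m2 A.
Proof.
move=> mS S1 S2 h0 m1h m2h coo A mA.
apply: (measure_unique [set U | measurable U /\ eopen U] (@cube R n)) => //.
- exact: measurable_eopen_generated.
- move=> U V [mU oU] [mV oV]; split; [exact: measurableI|exact: eopenI].
- by move=> k; split; [exact: measurable_cube|exact: eopen_cube].
- exact: bigcup_cube.
move=> U [mU oU]; apply/eqP; rewrite eq_le.
by rewrite (uniform_measure_le (h := h) (S := S))//= (uniform_measure_le (h := h) (S := S)).
Qed.

End uniformly_distributed.
(** * Orthogonal invariance of Lebesgue measure *)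

Section orthogonal_action.
Variables (R : realType) (n : nat).
Implicit Types (x y v : n.-tuple R) (Q : 'M[R]_n).

Definition tdot x y : R := \sum_(i < n) tnth x i * tnth y i.

Lemma tdotxx x : tdot x x = tsumsq x.
Proof. by apply: eq_bigr => i _; rewrite expr2. Qed.

Lemma tdot1 x : tdot x [tuple 1 | i < n] = tsum x.
Proof. by apply: eq_bigr => i _; rewrite tnth_mktuple mulr1. Qed.

Lemma sqd_tdot x y : sqd x y = tsumsq x - 2 * tdot x y + tsumsq y.
Proof.
rewrite /sqd /tsumsq /tdot mulr_sumr -sumrB -big_split /=.
by apply: eq_bigr => i _; ring.
Qed.

Lemma tsumsq_ge0 x : 0 <= tsumsq x.
Proof. by apply: sumr_ge0 => i _; exact: sqr_ge0. Qed.

Lemma tsumsq_eq0 x : tsumsq x = 0 -> x = [tuple 0 | i < n].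
Proof.
move=> /eqP; rewrite psumr_eq0 => [/allP x0|i _]; last exact: sqr_ge0.
apply: eq_from_tnth => i; rewrite tnth_mktuple; apply/eqP.
by rewrite -sqrf_eq0; exact: x0 (mem_index_enum _).
Qed.

Lemma tnth_mxact Q x i : tnth (mxact Q x) i = \sum_(j < n) Q i j * tnth x j.
Proof. by rewrite tnth_mktuple. Qed.

Lemma mxact_mul P Q x : mxact P (mxact Q x) = mxact (P *m Q) x.
Proof.
apply: eq_from_tnth => i; rewrite !tnth_mxact.
under eq_bigr do rewrite tnth_mxact mulr_sumr.
rewrite exchange_big/=; apply: eq_bigr => j _.
by rewrite mxE mulr_suml; apply: eq_bigr => k _; rewrite mulrA.
Qed.

Lemma mxact1 x : mxact 1%:M x = x.
Proof.
apply: eq_from_tnth => i; rewrite tnth_mxact (bigD1 i)//= mxE eqxx mul1r.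
by rewrite big1 ?addr0// => j ji; rewrite mxE eq_sym (negbTE ji) mul0r.
Qed.

Lemma tdot_mxact Q x y : tdot (mxact Q x) y = tdot x (mxact Q^T y).
Proof.
rewrite /tdot; under eq_bigr do rewrite tnth_mxact mulr_suml.
rewrite exchange_big/=; apply: eq_bigr => j _.
rewrite tnth_mxact mulr_sumr; apply: eq_bigr => i _.
by rewrite mxE mulrAC mulrC mulrA.
Qed.

Lemma orth_tr Q : Q *m Q^T = 1%:M -> Q^T *m Q = 1%:M.
Proof. exact: mulmx1C. Qed.

Lemma tsumsq_orth Q x : Q *m Q^T = 1%:M -> tsumsq (mxact Q x) = tsumsq x.
Proof.
by move=> /orth_tr QQ; rewrite -!tdotxx tdot_mxact mxact_mul QQ mxact1.
Qed.

Lemma sqd_orth Q x y : Q *m Q^T = 1%:M -> sqd (mxact Q x) (mxact Q y) = sqd x y.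
Proof.
move=> Qo; rewrite !sqd_tdot !tsumsq_orth// tdot_mxact mxact_mul orth_tr//.
by rewrite mxact1.
Qed.

Lemma preimage_mxact_eball Q x r : Q *m Q^T = 1%:M ->
  mxact Q @^-1` eball x r = eball (mxact Q^T x) r.
Proof.
move=> Qo; apply/seteqP; split => y /=; rewrite /eball/= => xy.
  by rewrite -(sqd_orth _ _ Qo) mxact_mul Qo mxact1.
by move: xy; rewrite -(sqd_orth _ _ Qo) mxact_mul Qo mxact1.
Qed.

Lemma measurable_mxact Q : measurable_fun setT (@mxact R n Q).
Proof.
apply/measurable_fun_tnthP => i.
rewrite (_ : _ \o _ = fun x => \sum_(j < n) Q i j * tnth x j).
  apply: measurable_sum => j; apply: measurable_funM => //.
  exact: measurable_tnth.
by apply/funext => x /=; rewrite tnth_mxact.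
Qed.

Lemma measurable_tsumsq : measurable_fun setT (@tsumsq R n).
Proof.
by apply: measurable_sum => j; apply: measurable_funX; exact: measurable_tnth.
Qed.

Lemma measurable_tsum : measurable_fun setT (@tsum R n).
Proof. by apply: measurable_sum => j; exact: measurable_tnth. Qed.

Definition householder v : 'M[R]_n :=
  1%:M - (2 / tsumsq v) *: ((\col_i tnth v i) *m (\col_i tnth v i)^T).

Lemma tr_householder v : (householder v)^T = householder v.
Proof. by rewrite /householder linearB/= linearZ/= trmx1 trmx_mul trmxK. Qed.

Lemma householder_orth v : householder v *m (householder v)^T = 1%:M.
Proof.
rewrite tr_householder /householder.
set V := \col_i tnth v i; set P := V *m V^T; set c := 2 / tsumsq v.
have PP : P *m P = tsumsq v *: P.
  rewrite /P mulmxA -(mulmxA V) (_ : V^T *m V = (tsumsq v)%:M).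
    by rewrite mul_mx_scalar scalemxAl.
  apply/matrixP => i j; rewrite !ord1 !mxE eqxx mulr1n.
  by apply: eq_bigr => k _; rewrite !mxE expr2.
rewrite mulmxBl mul1mx mulmxBr mulmx1 -scalemxAl -scalemxAr PP !scalerA.
suff -> : c * c * tsumsq v = c + c by rewrite scalerDl opprB addrK subrK.
rewrite /c; have [->|v0] := eqVneq (tsumsq v) 0; first by rewrite invr0 !mulr0 addr0.
by rewrite -mulrA divfK// mulr_natr mulr2n.
Qed.

Lemma tnth_householder v x i :
  tnth (mxact (householder v) x) i = tnth x i - 2 / tsumsq v * tdot v x * tnth v i.
Proof.
rewrite tnth_mxact /householder.
under eq_bigr do rewrite !mxE mulrBl.
rewrite sumrB; congr (_ - _).
  rewrite (bigD1 i)//= eqxx mul1r big1 ?addr0// => j ji.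
  by rewrite eq_sym (negbTE ji) mul0r.
rewrite /tdot mulr_sumr mulr_suml; apply: eq_bigr => j _.
by rewrite big_ord1 !mxE; ring.
Qed.

(* Vectors of equal norm are exchanged by the reflection in the hyperplane
   orthogonal to their difference. *)
Lemma householder_swap x y : tsumsq x = tsumsq y ->
  mxact (householder [tuple tnth x i - tnth y i | i < n]) x = y.
Proof.
move=> xy; set v := mktuple _; apply: eq_from_tnth => i.
rewrite tnth_householder.
have vE : tsumsq v = sqd x y by apply: eq_bigr => j _; rewrite tnth_mktuple.
have vx : tdot v x = tsumsq x - tdot x y.
  rewrite -tdotxx /tdot -sumrB; apply: eq_bigr => j _.
  by rewrite tnth_mktuple; ring.
have [v0|v0] := eqVneq (tsumsq v) 0.
  rewrite v0 invr0 mulr0 !mul0r subr0; apply/eqP; rewrite -subr_eq0.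
  by have := tsumsq_eq0 v0 => /(congr1 (fun t => tnth t i)); rewrite !tnth_mktuple => ->.
have -> : 2 / tsumsq v * tdot v x = 1.
  have : 2 * tdot v x = tsumsq v by rewrite vx vE sqd_tdot -xy; ring.
  by move=> e; rewrite mulrAC e divff.
by rewrite tnth_mktuple mul1r opprB addrC subrK.
Qed.

Lemma householder_fix1 v : tsum v = 0 -> orth_fix1 (householder v).
Proof.
move=> v0; split; first exact: householder_orth.
move=> i; have := tnth_householder v [tuple 1 | i < n] i.
rewrite tdot1 v0 mulr0 mul0r subr0 tnth_mxact tnth_mktuple => <-.
by apply: eq_bigr => j _; rewrite tnth_mktuple mulr1.
Qed.

End orthogonal_action.
Section lebesgue_translation.
Variable R : realType.
Local Notation mu := (@lebesgue_measure R).

Lemma lebesgue_measure_shift (c : R) (A : set R) : measurable A ->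
  pushforward mu (fun x : measurableTypeR R => x + c : measurableTypeR R) A = mu A.
Proof.
move=> mA.
have mc : measurable_fun setT (fun x : measurableTypeR R => x + c : measurableTypeR R).
  exact: measurable_funD.
apply/esym; apply: (@lebesgue_measure_unique R (pushm mu mc)) => // _ [[a b]] _ <-.
rewrite /pushm /pushforward/=.
have -> : (fun x : measurableTypeR R => x + c : measurableTypeR R) @^-1` `]a, b] =
    `]a - c, b - c]%classic.
  by apply/seteqP; split => x /=; rewrite !in_itv/= ltrBlDr lerBrDr.
rewrite !lebesgue_measure_itv/= !lte_fin ltrD2r.
by case: ifPn => // _; rewrite -!EFinB; congr EFin; ring.
Qed.

Lemma ge0_integral_shift (c : R) (f : R -> \bar R) :
  measurable_fun setT f -> (forall x, 0 <= f x)%E ->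
  (\int[mu]_x f (x + c)%R = \int[mu]_x f x)%E.
Proof.
move=> mf f0.
have mc : measurable_fun setT (fun x : measurableTypeR R => x + c : measurableTypeR R).
  exact: measurable_funD.
rewrite -(ge0_integral_pushm mu mc)//.
apply: eq_measure_integral => A mA _.
exact: lebesgue_measure_shift.
Qed.

End lebesgue_translation.

Section lebM_theory.
Variable R : realType.

Definition tadd n (x c : n.-tuple R) : n.-tuple R :=
  [tuple tnth x i + tnth c i | i < n].

Lemma tadd_cons n (a : R) (x : n.-tuple R) (c : n.+1.-tuple R) :
  tadd [tuple of a :: x] c =
  [tuple of a + thead c :: tadd x [tuple of behead c]].
Proof.
apply: eq_from_tnth => i; rewrite tnth_mktuple.
case: (unliftP ord0 i) => [j|] ->; last by rewrite !tnth0.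
by rewrite !tnthS tnth_mktuple [in LHS](tuple_eta c) tnthS.
Qed.

Lemma measurable_cons_section n (f : n.+1.-tuple R -> \bar R) a :
  measurable_fun setT f ->
  measurable_fun setT (fun t : n.-tuple R => f [tuple of a :: t]).
Proof. by move=> mf; apply: (measurableT_comp mf); exact: measurable_cons. Qed.

Lemma measurable_lebN_cons n (f : n.+1.-tuple R -> \bar R) :
  measurable_fun setT f -> (forall x, 0 <= f x)%E ->
  measurable_fun setT (fun a : R => lebN (fun t : n.-tuple R => f [tuple of a :: t])).
Proof.
move=> mf f0; pose g (z : measurableTypeR R * n.-tuple R) := f (tcons z).
have mg : measurable_fun setT g by exact: measurableT_comp (@measurable_tcons R n).
have h := @measurable_fun_fubini_tonelli_F _ _ _ _ _ (lebM R n) g mg (fun z => f0 _).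
rewrite (_ : (fun a : R => _) = fubini_F (lebM R n) g); first exact: h.
apply/funext => a; rewrite /fubini_F/= integral_lebM//.
  exact: measurable_cons_section.
by move=> t; exact: f0.
Qed.

Lemma lebN_shift n (c : n.-tuple R) (f : n.-tuple R -> \bar R) :
  measurable_fun setT f -> (forall x, 0 <= f x)%E ->
  lebN (fun x => f (tadd x c)) = lebN f.
Proof.
elim: n c f => [|n IH] c f mf f0 /=; first by congr f; rewrite !tuple0.
transitivity (\int[@lebesgue_measure R]_a
    lebN (fun t : n.-tuple R => f [tuple of (a + thead c)%R :: t]))%E.
  apply: eq_integral => a _.
  under eq_fun do rewrite tadd_cons.
  exact: (IH [tuple of behead c] (fun t => f [tuple of (a + thead c)%R :: t])
    (measurable_cons_section _ mf)).
apply: (ge0_integral_shift (thead c) (measurable_lebN_cons mf f0)) => a.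
rewrite -integral_lebM//; first exact: integral_ge0.
exact: measurable_cons_section.
Qed.

Lemma lebME n (A : set (n.-tuple R)) : measurable A ->
  lebM R n A = lebN (fun x => (\1_A x)%:E).
Proof.
move=> mA; rewrite -integral_lebM//; last exact/measurable_EFinP.
by rewrite integral_indic// setIT.
Qed.

Lemma lebM_eball n (x : n.-tuple R) r :
  lebM R n (eball x r) = lebM R n (eball [tuple 0 | i < n] r).
Proof.
rewrite !lebME; try exact: measurable_eball.
rewrite -(lebN_shift x).
- congr lebN; apply/funext => y; rewrite !indicE; congr ((nat_of_bool _)%:R%:E).
  have xy : sqd x (tadd y x) = sqd [tuple 0 | i < n] y.
    by apply: eq_bigr => i _; rewrite !tnth_mktuple; ring.
  by apply/idP/idP => /set_mem yr; apply/mem_set; move: yr; rewrite /eball/= xy.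
- apply/measurable_EFinP; apply: measurable_indic; exact: measurable_eball.
- by move=> y; rewrite lee_fin.
Qed.

Lemma lebMT_neq0 n : lebM R n setT != 0%E.
Proof.
elim: n => [|n IH] /=; first by rewrite diracT onee_neq0.
have -> : consm (lebM R n) setT = (@lebesgue_measure R setT * lebM R n setT)%E.
  by rewrite -product_measure1E// setXTT.
rewrite mule_neq0// gt_eqF//.
apply: (@lt_le_trans _ _ (@lebesgue_measure R `[0, 1]%classic)).
  by rewrite lebesgue_measure_itv/= lte_fin ltr01 oppr0 adde0 lte_fin ltr01.
by apply: le_measure => //; rewrite inE.
Qed.

Lemma lebM_cube n k : (lebM R n (@cube R n k) < +oo)%E.
Proof.
elim: n => [|n IH] /=.
  by rewrite diracE; case: (_ \in _); rewrite ltry.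
pose m2 := product_measure1 (@lebesgue_measure R) (lebM R n).
suff : (m2 (@tcons R n @^-1` @cube R n.+1 k) < +oo)%E by [].
apply: (@le_lt_trans _ _ (m2 (`[-k%:R, k%:R]%classic `*` @cube R n k))).
  apply: le_measure; rewrite ?inE.
  - rewrite -[X in measurable X]setTI; apply: measurable_tcons => //.
    exact: measurable_cube.
  - by apply: measurableX => //; exact: measurable_cube.
  - move=> [a t] /= at_; split => /=.
      by have := at_ ord0; rewrite tnth0 in_itv/= -ler_norml => /ltW.
    by move=> i; have := at_ (lift ord0 i); rewrite tnthS.
have kfin : @lebesgue_measure R `[-k%:R, k%:R]%classic \is a fin_num.
  by rewrite lebesgue_measure_itv/=; case: ifP => _; rewrite // -EFinB.
by rewrite /m2 product_measure1E ?lte_mul_pinfty//; exact: measurable_cube.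
Qed.

Lemma lebM_eball_fin n (x : n.-tuple R) r : (lebM R n (eball x r) < +oo)%E.
Proof.
rewrite lebM_eball; have [k rk] := @eball_sub_cube R n r.
apply: le_lt_trans (lebM_cube n k); apply: le_measure => //; rewrite inE.
  exact: measurable_eball.
exact: measurable_cube.
Qed.

Lemma lebM_orth n (Q : 'M[R]_n) (A : set (n.-tuple R)) : Q *m Q^T = 1%:M ->
  measurable A -> lebM R n (mxact Q @^-1` A) = lebM R n A.
Proof.
move=> Qo mA; pose m := pushm (lebM R n) (measurable_mxact Q).
have mball x r : m (eball x r) = lebM R n (eball [tuple 0 | i < n] r).
  rewrite /m /pushm /pushforward preimage_mxact_eball//; exact: lebM_eball.
have sf : sigma_finite setT m.
  exists (fun k => eball [tuple 0 | i < n] k%:R).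
    apply/esym; rewrite -subTset => x _.
    exists (Num.truncn (sqd [tuple 0 | i < n] x)).+1 => //.
    exact: truncnS_gt.
  by move=> k; split; [exact: measurable_eball|rewrite mball; exact: lebM_eball_fin].
pose m' : {sigma_finite_measure set (n.-tuple R) -> \bar R} :=
  HB.pack (pushm (lebM R n) (measurable_mxact Q))
    (Measure_isSigmaFinite.Build _ _ _ (pushm (lebM R n) (measurable_mxact Q)) sf).
pose h r := fine (lebM R n (eball [tuple 0 | i < n] r)).
have hE r : (h r)%:E = lebM R n (eball [tuple 0 | i < n] r).
  by rewrite fineK// ge0_fin_numE// lebM_eball_fin.
apply/esym; apply: (@uniform_measure_unique R n (lebM R n) m' setT h) => //.
- by rewrite setCT measure0.
- by rewrite setCT measure0.
- move=> r r0; rewrite -lte_fin hE lt0e measure_ge0 andbT.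
  apply: (@uniform_eball_neq0 R n (lebM R n) setT r) => //; first exact: lebMT_neq0.
  by move=> x _; exact: lebM_eball.
- by move=> x r _ _; rewrite hE; exact: lebM_eball.
- by move=> x r _ _; rewrite hE; exact: mball.
- by move=> k; exact: lebM_cube.
Qed.

Lemma lebN_orth n (Q : 'M[R]_n) (f : n.-tuple R -> \bar R) : Q *m Q^T = 1%:M ->
  measurable_fun setT f -> (forall x, 0 <= f x)%E ->
  lebN (fun x => f (mxact Q x)) = lebN f.
Proof.
move=> Qo mf f0; rewrite -!integral_lebM//; last first.
  exact: measurableT_comp mf (measurable_mxact Q).
rewrite -(ge0_integral_pushm (lebM R n) (measurable_mxact Q))//.
by apply: eq_measure_integral => A mA _; exact: lebM_orth.
Qed.

End lebM_theory.
(** * Gaussian moments *)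

Section gaussian_moments.
Variables (R : realType) (c : R).
Hypothesis c0 : 0 < c.
Local Notation mu := (@lebesgue_measure R).

Definition gauss_weight (x : R) := expR (- c * x ^+ 2).

Definition gauss_moment (k : nat) : \bar R :=
  (\int[mu]_x (x ^+ (2 * k) * gauss_weight x)%:E)%E.

Lemma is_derive_gauss_weight (x : R) :
  is_derive x 1 gauss_weight (- (2 * c * x) * gauss_weight x).
Proof.
have hq : is_derive x 1 (fun y : R => - c * y ^+ 2) (- (2 * c * x)).
  apply: (is_derive_eq (is_deriveZ (- c) (is_deriveX 2 (is_derive_id x 1)))).
  by rewrite /GRing.scale/=; ring.
apply: (is_derive_eq (@is_derive1_comp _ _ (fun y : R => - c * y ^+ 2) x _ _
  (is_derive_expR _) hq)).
by rewrite /gauss_weight; ring.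
Qed.

Lemma continuous_gauss_weight : continuous gauss_weight.
Proof.
move=> x; apply: differentiable_continuous; apply/derivable1_diffP.
exact: (@ex_derive _ _ _ _ _ _ _ (is_derive_gauss_weight x)).
Qed.

Lemma continuous_monomial_gauss (k : nat) : continuous (fun x : R => x ^+ k * gauss_weight x).
Proof.
move=> x; apply: cvgM; [exact: exprn_continuous|exact: continuous_gauss_weight].
Qed.

Lemma measurable_gauss_weight : measurable_fun setT gauss_weight.
Proof.
by apply: measurableT_comp => //; apply: measurable_funM => //; exact: measurable_funX.
Qed.

Lemma measurable_monomial_gauss (k : nat) :
  measurable_fun setT (fun x : R => x ^+ k * gauss_weight x).
Proof.
by apply: measurable_funM; [exact: measurable_funX|exact: measurable_gauss_weight].
Qed.

Lemma even_monomial_gauss_ge0 k x : 0 <= x ^+ (2 * k) * gauss_weight x.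
Proof. by rewrite mulr_ge0 ?expR_ge0// exprM exprn_ge0// sqr_ge0. Qed.

Lemma gauss_moment_half k :
  gauss_moment k = (2%:E * \int[mu]_(x in `[0%R, +oo[) (x ^+ (2 * k) * gauss_weight x)%:E)%E.
Proof.
rewrite /gauss_moment ge0_symfun_integralT.
- congr (_ * _)%E; congr (integral _ _ _).
  by apply/seteqP; split => x /=; rewrite in_itv/= andbT.
- exact: even_monomial_gauss_ge0.
- exact: continuous_monomial_gauss.
- by move=> x /=; rewrite /gauss_weight !exprM sqrrN.
Qed.

Lemma monomial_gauss_cvg0 k : (n%:R ^+ k * gauss_weight n%:R : R) @[n --> \oo] --> (0 : R).
Proof.
have H : forall n : nat, 0 <= (n.+1%:R ^+ k * gauss_weight n.+1%:R : R) <=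
    (k.+1`!%:R / c ^+ k.+1) * n.+1%:R^-1.
  move=> n; set x : R := n.+1%:R; have x0 : 0 < x by [].
  have x1 : 1 <= x by rewrite ler1n.
  apply/andP; split; first by rewrite mulr_ge0 ?expR_ge0// exprn_ge0// ltW.
  have cx0 : 0 <= c * x ^+ 2 by rewrite mulr_ge0 ?sqr_ge0// ltW.
  have := expR_ge1Dxn k cx0; rewrite /gauss_weight mulNr expRN => h.
  have f0 : 0 < (k.+1`!%:R : R) by rewrite ltr0n fact_gt0.
  have y0 : 0 < (c * x ^+ 2) ^+ k.+1 / k.+1`!%:R.
    by rewrite divr_gt0// exprn_gt0// mulr_gt0// exprn_gt0.
  have h2 : (c * x ^+ 2) ^+ k.+1 / k.+1`!%:R <= expR (c * x ^+ 2).
    by apply: le_trans h; rewrite lerDr.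
  apply: (@le_trans _ _ (x ^+ k * ((c * x ^+ 2) ^+ k.+1 / k.+1`!%:R)^-1)).
    apply: ler_wpM2l; first by rewrite exprn_ge0// ltW.
    by rewrite lef_pV2// posrE expR_gt0.
  have -> : x ^+ k * ((c * x ^+ 2) ^+ k.+1 / k.+1`!%:R)^-1 =
      k.+1`!%:R / c ^+ k.+1 * x^-1 * (x * x ^+ k)^-1.
    rewrite exprMn -exprM mul2n -addnn exprD (exprS x k).
    have u0 : x ^+ k != 0 by rewrite gt_eqF// exprn_gt0.
    have C0 : c ^+ k.+1 != 0 by rewrite gt_eqF// exprn_gt0.
    by field; rewrite u0 C0 !gt_eqF.
  rewrite ler_piMr//; last by rewrite -exprS invf_le1 ?exprn_ege1// exprn_gt0.
  by rewrite !mulr_ge0 ?invr_ge0 ?exprn_ge0 ?ltW.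
rewrite -cvg_shiftS.
apply: (squeeze_cvgr (nearW _ H)); first exact: cvg_cst.
rewrite -[X in _ --> X](mulr0 (k.+1`!%:R / c ^+ k.+1)).
by apply: cvgM; [exact: cvg_cst|exact: cvg_harmonic].
Qed.

(* Integration by parts against the derivative of the Gaussian weight. *)
Lemma gauss_moment_rec k :
  ((2 * c)%:E * gauss_moment k.+1 = (2 * k + 1)%:R%:E * gauss_moment k)%E.
Proof.
rewrite !gauss_moment_half muleCA [RHS]muleCA; congr (_ * _)%E.
pose I j (n : nat) := (\int[mu]_(x in `[0%R, n%:R]) (x ^+ (2 * j) * gauss_weight x)%:E)%E.
have cvgI j : I j n @[n --> \oo] -->
    (\int[mu]_(x in `[0%R, +oo[) (x ^+ (2 * j) * gauss_weight x)%:E)%E.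
  apply: ge0_cvgn_integral; first exact: even_monomial_gauss_ge0.
  exact: measurable_monomial_gauss.
have step n : ((2 * c)%:E * I k.+1 n.+1 + (n.+1%:R ^+ (2 * k + 1) * gauss_weight n.+1%:R)%:E =
    (2 * k + 1)%:R%:E * I k n.+1)%E.
  set b : R := n.+1%:R.
  have b0 : 0 < b by rewrite ltr0n.
  pose F (x : R) := x ^+ (2 * k + 1); pose f (x : R) := (2 * k + 1)%:R * x ^+ (2 * k).
  have dF (x : R) : is_derive x 1 F (f x).
    have -> : F = (id : R -> R) ^+ (2 * k + 1) by apply/funext => y; rewrite exprfctE.
    apply: (is_derive_eq (is_deriveX (2 * k + 1) (is_derive_id x 1))).
    by rewrite /GRing.scale/= mulr1 /f addn1.
  pose g (x : R) := - (2 * c * x) * gauss_weight x.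
  have cf : continuous f.
    by move=> x; rewrite /f; apply: cvgM; [exact: cvg_cst|exact: exprn_continuous].
  have cg : continuous g.
    move=> x; rewrite /g; apply: cvgM; last exact: continuous_gauss_weight.
    by apply: cvgN; apply: cvgM; [exact: cvg_cst|exact: cvg_id].
  have der (h dh : R -> R) : (forall x : R, is_derive x 1 h (dh x)) ->
      derivable_oo_LRcontinuous h 0 b.
    move=> hd; have ch : continuous h.
      move=> x; apply: differentiable_continuous; apply/derivable1_diffP.
      by case: (hd x).
    split.
    - by move=> x _; by case: (hd x).
    - by apply: cvg_at_right_filter; exact: ch.
    - by apply: cvg_at_left_filter; exact: ch.
  have der1 (h dh : R -> R) : (forall x : R, is_derive x 1 h (dh x)) ->
      {in `]0, b[, derive1 h =1 dh}.
    by move=> hd x _; rewrite derive1E (@derive_val _ _ _ _ _ _ _ (hd x)).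
  have := integration_by_parts b0 (continuous_subspaceT cf) (der _ _ dF) (der1 _ _ dF)
    (continuous_subspaceT cg) (der _ _ is_derive_gauss_weight) (der1 _ _ is_derive_gauss_weight).
  have intI j : mu.-integrable `[0, b] (fun x => (x ^+ (2 * j) * gauss_weight x)%:E).
    apply: continuous_compact_integrable; first exact: segment_compact.
    apply: continuous_subspaceT; exact: continuous_monomial_gauss.
  under eq_integral => x _.
    rewrite (_ : F x * g x = - (2 * c) * (x ^+ (2 * k.+1) * gauss_weight x)); last first.
      by rewrite /F /g mulnS !exprD expr1; move: (x ^+ (2 * k)) => p; ring.
    rewrite EFinM. over.
  rewrite integralZl//.
  under [X in _ = (_ - X)%E -> _]eq_integral => x _ do rewrite /f -mulrA EFinM.
  rewrite integralZl// /F expr0n addn_eq0 andbF mul0r subr0.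
  have := integrable_fin_num _ (intI k.+1); have := integrable_fin_num _ (intI k).
  rewrite -/(I k n.+1) -/(I k.+1 n.+1).
  move=> /(_ (measurable_itv _))/fineK <- /(_ (measurable_itv _))/fineK <-.
  rewrite -!EFinM -EFinB -EFinD => -[e]; congr EFin; move: e.
  by lra.
pose u n := ((2 * c)%:E * I k.+1 n.+1 + (n.+1%:R ^+ (2 * k + 1) * gauss_weight n.+1%:R)%:E)%E.
have uE : u = (fun n => (2 * k + 1)%:R%:E * I k n.+1)%E.
  by apply/funext => n; exact: step.
have lim1 : u n @[n --> \oo] -->
    ((2 * c)%:E * (\int[mu]_(x in `[0%R, +oo[) (x ^+ (2 * k.+1) * gauss_weight x)%:E) + 0%:E)%E.
  apply: cvgeD; first exact: fin_num_adde_defl.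
    by apply: cvgeZl => //; rewrite (cvg_shiftS (I k.+1)); exact: cvgI.
  apply: cvg_EFin; first exact: nearW.
  rewrite (cvg_shiftS (fun n => n%:R ^+ (2 * k + 1) * gauss_weight n%:R)).
  exact: monomial_gauss_cvg0.
have lim2 : u n @[n --> \oo] -->
    ((2 * k + 1)%:R%:E * (\int[mu]_(x in `[0%R, +oo[) (x ^+ (2 * k) * gauss_weight x)%:E))%E.
  by rewrite uE; apply: cvgeZl => //; rewrite (cvg_shiftS (I k)); exact: cvgI.
by rewrite adde0 in lim1; rewrite -(cvg_lim _ lim1)// -(cvg_lim _ lim2).
Qed.

Lemma gauss_moment0_fin : exists2 z : R, 0 < z & gauss_moment 0 = z%:E.
Proof.
pose s := Num.sqrt (2 * c)^-1.
have c20 : 0 < (2 * c)^-1 by rewrite invr_gt0 mulr_gt0.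
have s0 : s != 0 by rewrite gt_eqF// sqrtr_gt0.
exists (normal_peak s)^-1; first by rewrite invr_gt0 normal_peak_gt0.
have H := integral_normal_pdf (0 : R) s.
have p0 := normal_peak_gt0 s0.
have E x : (x ^+ (2 * 0) * gauss_weight x)%:E = ((normal_peak s)^-1%:E * (normal_pdf 0 s x)%:E)%E.
  rewrite -EFinM; congr EFin; rewrite muln0 expr0 mul1r /normal_pdf (negbTE s0).
  rewrite mulrA mulVf ?gt_eqF// mul1r /gauss_weight /normal_fun subr0.
  congr expR; rewrite sqr_sqrtr ?ltW// -mulr_natr.
  by field; rewrite gt_eqF.
rewrite /gauss_moment; under eq_integral do rewrite E.
rewrite ge0_integralZl_EFin//.
- by rewrite H mule1.
- by move=> x _; rewrite lee_fin normal_pdf_ge0.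
- by apply/measurable_EFinP; exact: measurable_normal_pdf.
- by rewrite invr_ge0 ltW.
Qed.

End gaussian_moments.
Local Ltac nonneg := repeat first
  [ assumption | exact: sqr_ge0 | exact: ler0n | apply: addr_ge0
  | apply: mulr_ge0 | rewrite invr_ge0 | apply: exprn_ge0 ].

Section density.
Import HBNNSimple.
Local Open Scope ereal_scope.
Context d (T : measurableType d) (R : realType).
Variables (nu m : {measure set T -> \bar R}) (w : T -> R).
Hypotheses (mw : measurable_fun setT w) (w0 : forall x, (0 <= w x)%R).
Hypothesis nuE : forall A, measurable A -> nu A = \int[m]_x (\1_A x * w x)%:E.

Lemma ge0_integral_density (f : T -> \bar R) :
  measurable_fun setT f -> (forall x, 0 <= f x) ->
  \int[nu]_x f x = \int[m]_x (f x * (w x)%:E).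
Proof.
move=> mf f0; pose f_ := nnsfun_approx measurableT mf.
have f_cvg x : (f_ n x)%:E @[n --> \oo] --> f x by exact: cvg_nnsfun_approx.
have f_nd x : {homo (fun n => f_ n x) : k l / (k <= l)%N >-> (k <= l)%R}.
  by move=> k l kl; exact/lefP/nd_nnsfun_approx.
transitivity (limn (fun n => \int[nu]_x (f_ n x)%:E)).
  rewrite -monotone_convergence//.
  - by apply: eq_integral => x _; apply/esym/cvg_lim.
  - by move=> n; exact/measurable_EFinP.
  - by move=> n x _; rewrite lee_fin.
  - by move=> x _ k l kl; rewrite lee_fin f_nd.
transitivity (limn (fun n => \int[m]_x ((f_ n x * w x)%:E))); last first.
  rewrite -monotone_convergence//.
  - apply: eq_integral => x _; apply/cvg_lim => //.
    by under eq_fun do rewrite EFinM; apply: cvgeZr.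
  - by move=> n; apply/measurable_EFinP; exact: measurable_funM.
  - by move=> n x _; rewrite lee_fin mulr_ge0.
  - by move=> x _ k l kl; rewrite lee_fin ler_wpM2r// f_nd.
congr (limn _); apply/funext => n; rewrite integralT_nnsfun sintegralE.
transitivity (\sum_(k \in range (f_ n))
    \int[m]_x (k * \1_(f_ n @^-1` [set k]) x * w x)%:E).
  apply: eq_fsbigr => r; rewrite inE => -[y _ <-].
  have mr : measurable (f_ n @^-1` [set f_ n y]) by [].
  rewrite nuE// -ge0_integralZl_EFin//.
  - by apply: eq_integral => x _; rewrite -EFinM mulrA.
  - by move=> x _; rewrite lee_fin mulr_ge0.
  - by apply/measurable_EFinP; apply: measurable_funM.
rewrite -ge0_integral_fsum//.
- apply: eq_integral => x _; rewrite fsumEFin//; congr EFin.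
  by rewrite -mulr_fsuml -fimfunE.
- move=> r; apply/measurable_EFinP; apply: measurable_funM => //.
  exact: measurable_funM.
- by move=> r x _; rewrite EFinM mule_ge0 ?lee_fin// -lee_fin nnfun_muleindic_ge0.
Qed.

End density.

Lemma ge0_integral_lin3 d (T : measurableType d) (R : realType)
    (m : {measure set T -> \bar R}) (f0 f1 f2 : T -> R) (a0 a1 a2 : R) :
  measurable_fun setT f0 -> measurable_fun setT f1 -> measurable_fun setT f2 ->
  (forall x, 0 <= f0 x) -> (forall x, 0 <= f1 x) -> (forall x, 0 <= f2 x) ->
  0 <= a0 -> 0 <= a1 -> 0 <= a2 ->
  (\int[m]_x (a0 * f0 x + a1 * f1 x + a2 * f2 x)%:E =
   a0%:E * \int[m]_x (f0 x)%:E + a1%:E * \int[m]_x (f1 x)%:E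
   + a2%:E * \int[m]_x (f2 x)%:E)%E.
Proof.
move=> m0 m1 m2 p0 p1 p2 q0 q1 q2.
have mZ (a : R) (f : T -> R) : measurable_fun setT f ->
    measurable_fun setT (fun x => (a * f x)%:E).
  by move=> mf; apply/measurable_EFinP; exact: measurable_funM.
have ZE (a : R) (f : T -> R) : 0 <= a -> measurable_fun setT f -> (forall x, 0 <= f x) ->
    (\int[m]_x (a * f x)%:E = a%:E * \int[m]_x (f x)%:E)%E.
  move=> a_ge0 mf f_ge0; under eq_integral do rewrite EFinM.
  by rewrite ge0_integralZl_EFin// => [x _|]; [rewrite lee_fin|exact/measurable_EFinP].
under eq_integral do rewrite !EFinD.
rewrite ge0_integralD//=; last 4 first.
- by move=> x _; rewrite -EFinD lee_fin addr_ge0// mulr_ge0.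
- by apply: emeasurable_funD; exact: mZ.
- by move=> x _; rewrite lee_fin mulr_ge0.
- exact: mZ.
rewrite ge0_integralD//=; last 4 first.
- by move=> x _; rewrite lee_fin mulr_ge0.
- exact: mZ.
- by move=> x _; rewrite lee_fin mulr_ge0.
- exact: mZ.
by rewrite !ZE.
Qed.

Section gaussian_quadratic_moments.
Variable R : realType.
Local Notation mu := (@lebesgue_measure R).

Lemma gauss_moments (c : R) : 0 < c -> exists2 z : R, 0 < z &
  forall b0 b1 b2 : R, 0 <= b0 -> 0 <= b1 -> 0 <= b2 ->
  (\int[mu]_x ((b0 + b1 * x ^+ 2 + b2 * x ^+ 4) * gauss_weight c x)%:E =
   (z * (b0 + b1 / (2 * c) + b2 * 3 / (4 * c ^+ 2)))%:E)%E.
Proof.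
move=> c0; have [z z0 zE] := gauss_moment0_fin c0; exists z => // b0 b1 b2 p0 p1 p2.
have cn0 : c != 0 by rewrite gt_eqF.
have half k (y : R) : gauss_moment c k = y%:E ->
    gauss_moment c k.+1 = ((2 * k + 1)%:R / (2 * c) * y)%:E.
  move=> ky; have := gauss_moment_rec c0 k; rewrite ky -EFinM.
  move=> /(congr1 (fun e => (2 * c)^-1%:E * e)%E).
  by rewrite muleA -!EFinM mulVf ?mulf_neq0// mul1e => ->; congr EFin; field.
have E1 := half _ _ zE; have E2 := half _ _ E1.
under eq_integral => x _.
  rewrite (_ : _ * _ = b0 * (x ^+ (2 * 0) * gauss_weight c x)
    + b1 * (x ^+ (2 * 1) * gauss_weight c x)
    + b2 * (x ^+ (2 * 2) * gauss_weight c x)); last by rewrite muln0 muln1; ring.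
  over.
rewrite ge0_integral_lin3//; try exact: measurable_monomial_gauss;
  try exact: even_monomial_gauss_ge0.
rewrite -!/(gauss_moment c _) zE E1 E2 -!EFinM -!EFinD; congr EFin.
by field.
Qed.

Lemma lebN_gauss_moments (c : R) : 0 < c -> exists2 z : R, 0 < z &
  forall n (a0 a1 a2 : R), 0 <= a0 -> 0 <= a1 -> 0 <= a2 ->
  lebN (fun t : n.-tuple R =>
    ((a0 + a1 * tsumsq t + a2 * tsumsq t ^+ 2) * expR (- c * tsumsq t))%:E) =
  (z ^+ n * (a0 + a1 * (n%:R / (2 * c)) + a2 * (n%:R * (n%:R + 2) / (4 * c ^+ 2))))%:E.
Proof.
move=> c0; have [z z0 zE] := gauss_moments c0; exists z => //.
have cn0 : c != 0 by rewrite gt_eqF.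
elim=> [|n IH] a0 a1 a2 p0 p1 p2.
  rewrite /= /tsumsq big_ord0 expr0n/= !mulr0 !mul0r expR0 expr0 !mul1r.
  by rewrite !mulr0 !addr0 mulr1.
have tc x (t : n.-tuple R) : tsumsq [tuple of x :: t] = x ^+ 2 + tsumsq t.
  rewrite /tsumsq big_ord_recl tnth0; congr (_ + _).
  by apply: eq_bigr => i _; rewrite tnthS.
transitivity (\int[mu]_x ((z ^+ n * (a0 + a1 * (n%:R / (2 * c)) + a2 * (n%:R * (n%:R + 2) / (4 * c ^+ 2)))
    + z ^+ n * (a1 + a2 * (n%:R / c)) * x ^+ 2 + z ^+ n * a2 * x ^+ 4)
    * gauss_weight c x)%:E)%E.
  rewrite /=; apply: eq_integral => x _.
  have W0 : 0 <= gauss_weight c x by exact: expR_ge0.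
  transitivity (lebN (fun t : n.-tuple R =>
    (((a0 + a1 * x ^+ 2 + a2 * x ^+ 4) * gauss_weight c x
      + (a1 + 2 * a2 * x ^+ 2) * gauss_weight c x * tsumsq t
      + a2 * gauss_weight c x * tsumsq t ^+ 2) * expR (- c * tsumsq t))%:E)).
    congr lebN; apply/funext => t; congr EFin.
    by rewrite tc (mulrDr (- c)) expRD -/(gauss_weight c x); ring.
  have x20 : 0 <= x ^+ 2 by exact: sqr_ge0.
  have x40 : 0 <= x ^+ 4 by rewrite (exprM x 2 2) sqr_ge0.
  rewrite IH.
  - by congr EFin; field.
  - by nonneg.
  - by nonneg.
  - by nonneg.
have zn : 0 <= z ^+ n by rewrite exprn_ge0// ltW.
have c00 := ltW c0.
rewrite zE.
- by congr EFin; rewrite (exprSr z n) -(natr1 n); field.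
- by nonneg.
- by nonneg.
- by nonneg.
Qed.

End gaussian_quadratic_moments.
(** * The two ensembles *)

Section microcanonical.
Variables (R : realType) (N : nat).
Implicit Types (P : probability (N.-tuple R) R) (x y : N.-tuple R).

Lemma measurable_mc_surface rho : measurable (@mc_surface R N rho).
Proof.
have -> : @mc_surface R N rho = (@tsum R N @^-1` [set 0]) `&`
    (@tsumsq R N @^-1` [set rho * N%:R]) by [].
apply: measurableI; rewrite -[X in measurable X]setTI.
  exact: measurable_tsum.
exact: measurable_tsumsq.
Qed.

Lemma tdotBl x y z : tdot [tuple tnth x i - tnth y i | i < N] z = tdot x z - tdot y z.
Proof.
by rewrite /tdot -sumrB; apply: eq_bigr => i _; rewrite tnth_mktuple mulrBl.
Qed.

Lemma is_MC_eball rho P x y r : is_MC rho P ->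
  mc_surface rho x -> mc_surface rho y -> P (eball x r) = P (eball y r).
Proof.
move=> [_ Pinv] [x0 xr] [y0 yr].
pose H := householder [tuple tnth x i - tnth y i | i < N].
have Hf : orth_fix1 H.
  by apply: householder_fix1; rewrite -tdot1 tdotBl !tdot1 x0 y0 subrr.
have Hx : mxact H x = y by apply: householder_swap; rewrite xr yr.
rewrite -(Pinv _ Hf (eball y r)); last exact: measurable_eball.
rewrite preimage_mxact_eball; last by case: Hf.
have <- : mxact H^T y = x by rewrite -Hx mxact_mul orth_tr ?mxact1//; case: Hf.
by [].
Qed.

Lemma is_MC_unique rho P1 P2 : is_MC rho P1 -> is_MC rho P2 ->
  forall A, measurable A -> P1 A = P2 A.
Proof.
move=> MC1 MC2; set S := @mc_surface R N rho.
have mS : measurable S by exact: measurable_mc_surface.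
have [x0 Sx0] : exists x, S x.
  apply/set0P/eqP => S0; have [] := MC1; rewrite -/S S0 measure0 => /eqP.
  by rewrite eq_sym onee_eq0.
have conull P : is_MC rho P -> P (~` S) = 0%E.
  by move=> [PS _]; rewrite probability_setC// PS subee.
have ballc P x r : is_MC rho P -> S x -> P (eball x r) = P (eball x0 r).
  by move=> MCP Sx; exact: is_MC_eball MCP Sx Sx0.
pose h r := fine (P1 (eball x0 r)).
have hE r : (h r)%:E = P1 (eball x0 r).
  by rewrite fineK// fin_num_measure//; exact: measurable_eball.
have P12 r : P1 (eball x0 r) = P2 (eball x0 r).
  have : (P2 (eball x0 r) * P1 S = P1 (eball x0 r) * P2 S)%E.
    apply: (@uniform_eball_swap R N P1 P2 S r _ _ mS (conull _ MC1) (conull _ MC2)).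
      by move=> x; exact: ballc.
    by move=> x; exact: ballc.
  by have [-> _] := MC1; have [-> _] := MC2; rewrite !mule1.
apply: (@uniform_measure_unique R N P1 P2 S h) => //.
- exact: conull.
- exact: conull.
- move=> r r0; rewrite -lte_fin hE lt0e measure_ge0 andbT.
  apply: (@uniform_eball_neq0 R N P1 S r) => //.
    suff : P1 S != 0%E by [].
    by have [-> _] := MC1; rewrite onee_neq0.
  by move=> x Sx; exact: ballc.
- by move=> x r Sx _; rewrite hE; exact: ballc.
- by move=> x r Sx _; rewrite hE P12; exact: ballc.
- move=> k; apply: le_lt_trans (probability_le1 _ _) _; rewrite ?ltry//.
  exact: measurable_cube.
Qed.

End microcanonical.
Section radial_projection.
Variables (R : realType) (N : nat).
Implicit Types (x y : N.-tuple R) (Q : 'M[R]_N).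

Definition tperp x : N.-tuple R := [tuple tnth x i - tsum x / N%:R | i < N].

Definition rad2 x : R := tsumsq (tperp x).

(* Since [x / 0 = 0], this is the zero vector when [rad2 x = 0]. *)
Definition mc_proj (A : R) x : N.-tuple R :=
  [tuple Num.sqrt A / Num.sqrt (rad2 x) * tnth (tperp x) i | i < N].

Lemma rad2_ge0 x : 0 <= rad2 x.
Proof. exact: tsumsq_ge0. Qed.

Lemma tsum_scale (c : R) x : tsum [tuple c * tnth x i | i < N] = c * tsum x.
Proof. by rewrite /tsum mulr_sumr; apply: eq_bigr => i _; rewrite tnth_mktuple. Qed.

Lemma tsumsq_scale (c : R) x : tsumsq [tuple c * tnth x i | i < N] = c ^+ 2 * tsumsq x.
Proof.
by rewrite /tsumsq mulr_sumr; apply: eq_bigr => i _; rewrite tnth_mktuple exprMn.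
Qed.

Lemma mxact_scale Q (c : R) x :
  mxact Q [tuple c * tnth x i | i < N] = [tuple c * tnth (mxact Q x) i | i < N].
Proof.
apply: eq_from_tnth => i; rewrite [RHS]tnth_mktuple !tnth_mxact mulr_sumr.
by apply: eq_bigr => j _; rewrite tnth_mktuple mulrCA.
Qed.

Hypothesis N0 : (0 < N)%N.
Let NR : (N%:R : R) != 0. Proof. by rewrite pnatr_eq0 -lt0n. Qed.

Lemma tsum_tperp x : tsum (tperp x) = 0.
Proof.
rewrite /tsum; under eq_bigr do rewrite tnth_mktuple.
by rewrite sumrB sumr_const card_ord -[X in _ - X]mulr_natr divfK// subrr.
Qed.

Lemma rad2E x : rad2 x = tsumsq x - tsum x ^+ 2 / N%:R.
Proof.
rewrite /rad2 {1}/tsumsq; under eq_bigr do rewrite tnth_mktuple sqrrB.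
rewrite big_split/= sumrB sumr_const card_ord -/(tsumsq x) -[X in _ + X]mulr_natr.
rewrite (_ : \sum_(i < N) _ = 2 * (tsum x / N%:R) * tsum x); first by field.
rewrite /tsum mulr_sumr; apply: eq_bigr => i _.
by ring.
Qed.

Lemma tsum_mxact Q x : orth_fix1 Q -> tsum (mxact Q x) = tsum x.
Proof.
move=> [QQ Q1]; rewrite -!tdot1 tdot_mxact; congr tdot.
have E : mxact Q [tuple 1 | i < N] = [tuple 1 | i < N].
  apply: eq_from_tnth => i; rewrite tnth_mxact tnth_mktuple -[RHS](Q1 i).
  by apply: eq_bigr => j _; rewrite tnth_mktuple mulr1.
by rewrite -[in LHS]E mxact_mul orth_tr// mxact1.
Qed.

Lemma tperp_mxact Q x : orth_fix1 Q -> tperp (mxact Q x) = mxact Q (tperp x).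
Proof.
move=> Qf; apply: eq_from_tnth => i; rewrite tnth_mktuple tsum_mxact// !tnth_mxact.
under [RHS]eq_bigr do rewrite tnth_mktuple mulrBr.
by rewrite sumrB -mulr_suml; case: Qf => _ ->; rewrite mul1r.
Qed.

Lemma rad2_mxact Q x : orth_fix1 Q -> rad2 (mxact Q x) = rad2 x.
Proof. by move=> Qf; rewrite /rad2 tperp_mxact// tsumsq_orth//; case: Qf. Qed.

Lemma mc_proj_mxact A Q x : orth_fix1 Q ->
  mc_proj A (mxact Q x) = mxact Q (mc_proj A x).
Proof. by move=> Qf; rewrite /mc_proj mxact_scale rad2_mxact// tperp_mxact. Qed.

Lemma mc_proj_surface rho x : 0 <= rho -> rad2 x != 0 ->
  mc_surface rho (mc_proj (rho * N%:R) x).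
Proof.
move=> rho0 x0; split; first by rewrite tsum_scale tsum_tperp mulr0.
rewrite tsumsq_scale -/(rad2 x) expr_div_n !sqr_sqrtr ?rad2_ge0//.
  by rewrite divfK.
by rewrite mulr_ge0.
Qed.

Lemma measurable_tperp : measurable_fun setT tperp.
Proof.
apply/measurable_fun_tnthP => i.
rewrite (_ : _ \o _ = fun x => tnth x i - tsum x / N%:R).
  apply: measurable_funB; first exact: measurable_tnth.
  by apply: measurable_funM => //; exact: measurable_tsum.
by apply/funext => x /=; rewrite tnth_mktuple.
Qed.

Lemma measurable_rad2 : measurable_fun setT rad2.
Proof. exact: measurableT_comp (@measurable_tsumsq R N) measurable_tperp. Qed.

Lemma measurable_mc_proj A : measurable_fun setT (mc_proj A).
Proof.
apply/measurable_fun_tnthP => i.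
rewrite (_ : _ \o _ = fun x => Num.sqrt A * (rad2 x `^ (- 2^-1)) * tnth (tperp x) i).
  apply: measurable_funM.
    apply: measurable_funM => //.
    exact: (measurableT_comp (measurable_powR _) measurable_rad2).
  exact: (measurableT_comp (@measurable_tnth _ _ N i) measurable_tperp).
apply/funext => x /=.
by rewrite tnth_mktuple powRN powR12_sqrt// rad2_ge0.
Qed.

Lemma cost_mc_proj A x : 0 < A ->
  cost (x, mc_proj A x) <= N%:R^-1 * (tsum x ^+ 2 / N%:R + (rad2 x - A) ^+ 2 / A).
Proof.
move=> A0; rewrite /cost ler_wpM2l ?invr_ge0//=.
set l := Num.sqrt A / Num.sqrt (rad2 x).
have -> : \sum_(i < N) (tnth x i - tnth (mc_proj A x) i) ^+ 2 =
    tsum x ^+ 2 / N%:R + (1 - l) ^+ 2 * rad2 x.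
  transitivity (\sum_(i < N) ((tsum x / N%:R) ^+ 2 +
      (2 * (tsum x / N%:R) * (1 - l) * tnth (tperp x) i + (1 - l) ^+ 2 * tnth (tperp x) i ^+ 2))).
    apply: eq_bigr => i _; rewrite !tnth_mktuple -/l; ring.
  rewrite big_split/= sumr_const card_ord big_split/= -!mulr_sumr -/(tsum (tperp x)) tsum_tperp mulr0 add0r.
  congr (_ + _); transitivity ((tsum x / N%:R) ^+ 2 * N%:R); last by field.
  by rewrite mulr_natr.
rewrite lerD2l; have [r0|r0] := eqVneq (rad2 x) 0.
  by rewrite r0 mulr0 mulr_ge0 ?sqr_ge0// invr_ge0 ltW.
have rp : 0 < rad2 x by rewrite lt_neqAle eq_sym r0 rad2_ge0.
have l0 : 0 < l by rewrite divr_gt0// sqrtr_gt0.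
have -> : A = l ^+ 2 * rad2 x.
  by rewrite expr_div_n !sqr_sqrtr ?rad2_ge0 ?(ltW A0)// divfK.
have -> : (rad2 x - l ^+ 2 * rad2 x) ^+ 2 / (l ^+ 2 * rad2 x) =
    (1 - l) ^+ 2 * rad2 x * ((1 + l) / l) ^+ 2.
  by field; rewrite r0 gt_eqF.
rewrite ler_peMr//; first by rewrite mulr_ge0 ?sqr_ge0// ltW.
by rewrite exprn_ege1// ler_pdivlMr// mul1r lerDr.
Qed.

End radial_projection.
Section grand_canonical.
Variable R : realType.
Local Notation leb := (@lebesgue_measure R).

(* The rotation exchanging the first basis vector and the normalized mean
   direction turns the mean-field weight into a product weight. *)
Lemma mean_rotation n : exists2 Q : 'M[R]_n.+1, Q *m Q^T = 1%:M &
  forall y, tsum (mxact Q y) ^+ 2 / n.+1%:R = thead y ^+ 2 /\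
    rad2 (mxact Q y) = tsumsq [tuple of behead y].
Proof.
pose c : R := Num.sqrt n.+1%:R.
have c2 : c ^+ 2 = n.+1%:R by rewrite sqr_sqrtr.
have c0 : c != 0 by rewrite gt_eqF// sqrtr_gt0.
pose e : n.+1.-tuple R := [tuple (i == ord0)%:R | i < n.+1].
pose u : n.+1.-tuple R := [tuple c^-1 | i < n.+1].
have eu : tsumsq e = tsumsq u.
  rewrite /tsumsq [LHS](bigD1 ord0)//= tnth_mktuple eqxx expr1n big1 ?addr0.
    under eq_bigr do rewrite tnth_mktuple exprVn c2.
    by rewrite sumr_const card_ord -[RHS]mulr_natr mulVf.
  by move=> i /negbTE i0; rewrite tnth_mktuple i0 expr0n.
pose Q := householder [tuple tnth e i - tnth u i | i < n.+1].
have Qo : Q *m Q^T = 1%:M by exact: householder_orth.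
have Qe : mxact Q e = u by exact: householder_swap.
have tQ y : tsum (mxact Q y) = c * thead y.
  transitivity (c * tdot (mxact Q y) u).
    rewrite /tdot mulr_sumr; apply: eq_bigr => i _.
    by rewrite [tnth u i]tnth_mktuple mulrCA divff// mulr1.
  rewrite tdot_mxact -Qe mxact_mul orth_tr// mxact1; congr (_ * _).
  rewrite /tdot (bigD1 ord0)//= tnth_mktuple eqxx mulr1 big1 ?addr0//.
  by move=> i /negbTE i0; rewrite tnth_mktuple i0 mulr0.
exists Q => // y; have sq : tsum (mxact Q y) ^+ 2 / n.+1%:R = thead y ^+ 2.
  by rewrite tQ exprMn c2 mulrAC divff// mul1r.
split=> //; rewrite rad2E// sq tsumsq_orth// [in LHS](tuple_eta y).
rewrite /tsumsq big_ord_recl tnth0 addrAC subrr add0r.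
by apply: eq_bigr => i _; rewrite tnthS.
Qed.

Lemma lebNS n (f : n.+1.-tuple R -> \bar R) :
  lebN f = (\int[leb]_x lebN (fun t : n.-tuple R => f [tuple of x :: t]))%E.
Proof. by []. Qed.

Lemma lebM_cons_setX n (A : set R) (B : set (n.-tuple R)) :
  measurable A -> measurable B ->
  lebM R n.+1 (@tuncons R n @^-1` (A `*` B)) = (leb A * lebM R n B)%E.
Proof.
move=> mA mB; rewrite -(product_measure1E leb (lebM R n) mA mB) /=.
rewrite /consm /pushm /pushforward -comp_preimage.
rewrite (_ : @tuncons R n \o @tcons R n = id)//.
by apply/funext => x; exact: tconsK.
Qed.

Lemma measurable_tsumsq_eq0 n : measurable [set t : n.-tuple R | tsumsq t = 0].
Proof.
rewrite -[X in measurable X]setTI.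
exact: (@measurable_tsumsq R n measurableT [set 0] (measurable_set1 _)).
Qed.

Lemma lebM_tsumsq_eq0 n : lebM R n.+1 [set t | tsumsq t = 0] = 0%E.
Proof.
have m0 : measurable (@tuncons R n @^-1` ([set 0] `*` setT)).
  rewrite -[X in measurable X]setTI; apply: measurable_tuncons => //.
  by apply: measurableX => //; exact: measurable_set1.
apply/eqP; rewrite -measure_le0.
apply: (@le_trans _ _ (lebM R n.+1 (@tuncons R n @^-1` ([set 0] `*` setT)))).
  apply: le_measure; rewrite ?inE//; first exact: measurable_tsumsq_eq0.
  by move=> t /= /tsumsq_eq0 ->; split => //=; rewrite /thead tnth_mktuple.
by rewrite lebM_cons_setX// lebesgue_measure_set1 mul0e.
Qed.

Lemma lebM_rad2_eq0 n : lebM R n.+2 [set x | rad2 x = 0] = 0%E.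
Proof.
have mr : measurable [set x : n.+2.-tuple R | rad2 x = 0].
  rewrite -[X in measurable X]setTI.
  exact: (@measurable_rad2 R n.+2 measurableT [set 0] (measurable_set1 _)).
have [Q Qo QE] := mean_rotation n.+1.
rewrite -(lebM_orth Qo mr).
rewrite (_ : _ @^-1` _ = @tuncons R n.+1 @^-1` (setT `*` [set t | tsumsq t = 0])).
  rewrite lebM_cons_setX//; last exact: measurable_tsumsq_eq0.
  by rewrite lebM_tsumsq_eq0 mule0.
apply/seteqP; split => y /=; have [_ ->] := QE y.
  by move=> y0; split.
by case.
Qed.

Section weight.
Variables (n : nat) (J mu beta : R).
Hypotheses (mu0 : 0 < mu) (a0 : 0 < mu - beta * J / 2).
Local Notation a := (mu - beta * J / 2).
Local Notation N := n.+2.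
Implicit Types (x : N.-tuple R).

Lemma gc_weightE x : gc_weight beta mu J x =
  gauss_weight a (tsum x / Num.sqrt N%:R) * expR (- mu * rad2 x).
Proof.
rewrite /gc_weight /gauss_weight -expRD; congr expR.
rewrite rad2E// /Ham expr_div_n sqr_sqrtr// -[N%:R *+ 2]mulr_natr.
by field.
Qed.

Lemma gc_weight_mxact (Q : 'M[R]_N) x : orth_fix1 Q ->
  gc_weight beta mu J (mxact Q x) = gc_weight beta mu J x.
Proof. by move=> Qf; rewrite !gc_weightE rad2_mxact// tsum_mxact. Qed.

Lemma measurable_gc_weight : measurable_fun setT (@gc_weight R beta mu J N).
Proof.
apply: measurableT_comp => //; apply: measurable_funB.
  apply: (@measurable_funM _ _ _ _ (cst (- beta)) (@Ham R J N)) => //.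
  by apply: measurable_funM => //; apply: measurable_funX; exact: measurable_tsum.
by apply: measurable_funM => //; exact: measurable_tsumsq.
Qed.

Lemma gc_weight_ge0 x : 0 <= gc_weight beta mu J x.
Proof. exact: expR_ge0. Qed.

Definition gc_poly (b0 b1 b2 c : R) x : R :=
  b0 + b1 * rad2 x + b2 * rad2 x ^+ 2 + c * (tsum x ^+ 2 / N%:R).

Lemma measurable_gc_poly b0 b1 b2 c : measurable_fun setT (gc_poly b0 b1 b2 c).
Proof.
have mr := @measurable_rad2 R N.
apply: measurable_funD.
  apply: measurable_funD.
    by apply: measurable_funD => //; exact: measurable_funM.
  by apply: measurable_funM => //; exact: measurable_funX.
apply: measurable_funM => //; apply: measurable_funM => //.
by apply: measurable_funX; exact: measurable_tsum.
Qed.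

Lemma gc_poly_ge0 b0 b1 b2 c x : 0 <= b0 -> 0 <= b1 -> 0 <= b2 -> 0 <= c ->
  0 <= gc_poly b0 b1 b2 c x.
Proof.
move=> p0 p1 p2 pc; have r0 := rad2_ge0 x.
have t0 : 0 <= tsum x ^+ 2 / N%:R by rewrite mulr_ge0 ?sqr_ge0.
by rewrite /gc_poly; nonneg.
Qed.

Lemma lebN_gc_poly : exists2 K : R, 0 < K &
  forall b0 b1 b2 c : R, 0 <= b0 -> 0 <= b1 -> 0 <= b2 -> 0 <= c ->
  lebN (fun x => (gc_poly b0 b1 b2 c x * gc_weight beta mu J x)%:E) =
  (K * (b0 + b1 * (n.+1%:R / (2 * mu))
    + b2 * (n.+1%:R * (n.+1%:R + 2) / (4 * mu ^+ 2)) + c / (2 * a)))%:E.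
Proof.
have [z z0 zE] := lebN_gauss_moments mu0; have [y y0 yE] := gauss_moments a0.
exists (y * z ^+ n.+1); first by rewrite mulr_gt0// exprn_gt0.
move=> b0 b1 b2 c p0 p1 p2 pc.
have [Q Qo QE] := mean_rotation n.+1.
rewrite -(lebN_orth Qo); last 2 first.
- apply/measurable_EFinP; apply: measurable_funM; first exact: measurable_gc_poly.
  exact: measurable_gc_weight.
- by move=> x; rewrite lee_fin mulr_ge0 ?gc_weight_ge0 ?gc_poly_ge0.
have m0 : 0 <= mu by exact: ltW.
set v := b0 + b1 * (n.+1%:R / (2 * mu)) + b2 * (n.+1%:R * (n.+1%:R + 2) / (4 * mu ^+ 2)).
have v0 : 0 <= v.
  by rewrite /v; nonneg.
transitivity (\int[leb]_x ((z ^+ n.+1 * v + z ^+ n.+1 * c * x ^+ 2 + 0 * x ^+ 4)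
    * gauss_weight a x)%:E)%E.
  rewrite lebNS; apply: eq_integral => x _.
  have W0 : 0 <= gauss_weight a x by exact: expR_ge0.
  transitivity (lebN (fun t : n.+1.-tuple R =>
    (((b0 + c * x ^+ 2) * gauss_weight a x + b1 * gauss_weight a x * tsumsq t
      + b2 * gauss_weight a x * tsumsq t ^+ 2) * expR (- mu * tsumsq t))%:E)).
    congr lebN; apply/funext => t; congr EFin.
    have [] := QE [tuple of x :: t]; rewrite theadE.
    rewrite (_ : [tuple of behead [tuple of x :: t]] = t); last exact: val_inj.
    move=> ts rs; rewrite gc_weightE /gc_poly ts rs.
    rewrite (_ : gauss_weight _ (_ / _) = gauss_weight a x); first by ring.
    by rewrite /gauss_weight expr_div_n sqr_sqrtr// ts.
  rewrite zE.
  - by congr EFin; rewrite /v; ring.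
  - by nonneg.
  - by nonneg.
  - by nonneg.
have zn : 0 <= z ^+ n.+1 by rewrite exprn_ge0// ltW.
rewrite yE ?mulr_ge0//; congr EFin; field.
rewrite (_ : _ - _ = 2 * a); last by field.
by rewrite gt_eqF// mulr_gt0.
Qed.

Variable P : probability (N.-tuple R) R.
Hypothesis GC : is_GC beta mu J P.

Lemma gc_integral : exists2 K : R, 0 < K &
  forall f : N.-tuple R -> \bar R, measurable_fun setT f -> (forall x, 0 <= f x)%E ->
  (K%:E * \int[P]_x f x = lebN (fun x => f x * (gc_weight beta mu J x)%:E))%E.
Proof.
have [K K0 KE] := lebN_gc_poly; exists K => // f mf f0.
have Z : lebN (fun x : N.-tuple R => (gc_weight beta mu J x)%:E) = K%:E.
  transitivity (lebN (fun x => (gc_poly 1 0 0 0 x * gc_weight beta mu J x)%:E)).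
    by congr lebN; apply/funext => x; rewrite /gc_poly !mul0r !addr0 mul1r.
  by rewrite KE// !mul0r !addr0 mulr1.
pose k : {nonneg R} := NngNum (ltW K0).
rewrite -[LHS](@ge0_integral_mscale _ _ R P setT measurableT k)//.
rewrite -integral_lebM; last 2 first.
- by apply: emeasurable_funM => //; apply/measurable_EFinP; exact: measurable_gc_weight.
- by move=> x; rewrite mule_ge0// lee_fin gc_weight_ge0.
apply: ge0_integral_density => //.
- exact: measurable_gc_weight.
- exact: gc_weight_ge0.
move=> A mA; rewrite /mscale/= integral_lebM.
- by have := GC mA; rewrite Z muleC.
- apply/measurable_EFinP; apply: measurable_funM => //.
  exact: measurable_gc_weight.
- by move=> x; rewrite lee_fin mulr_ge0 ?gc_weight_ge0.
Qed.

Lemma gc_integral_poly (b0 b1 b2 c : R) : 0 <= b0 -> 0 <= b1 -> 0 <= b2 -> 0 <= c ->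
  (\int[P]_x (gc_poly b0 b1 b2 c x)%:E = (b0 + b1 * (n.+1%:R / (2 * mu))
    + b2 * (n.+1%:R * (n.+1%:R + 2) / (4 * mu ^+ 2)) + c / (2 * a))%:E)%E.
Proof.
have [K K0 KE] := lebN_gc_poly; have [L L0 LE] := gc_integral.
have eE (p0 p1 p2 q : R) : 0 <= p0 -> 0 <= p1 -> 0 <= p2 -> 0 <= q ->
    (L%:E * \int[P]_x (gc_poly p0 p1 p2 q x)%:E = (K * (p0 + p1 * (n.+1%:R / (2 * mu))
    + p2 * (n.+1%:R * (n.+1%:R + 2) / (4 * mu ^+ 2)) + q / (2 * a)))%:E)%E.
  move=> ? ? ? ?; rewrite LE; first by rewrite -KE.
    by apply/measurable_EFinP; exact: measurable_gc_poly.
  by move=> x; rewrite lee_fin gc_poly_ge0.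
have LK : L = K.
  have P1 : (\int[P]_x (gc_poly 1 0 0 0 x)%:E = 1)%E.
    rewrite (eq_integral (cst 1%E)) => [|x _]; last first.
      by rewrite /gc_poly !mul0r !addr0.
    by rewrite integral_cst// mul1e; exact: probability_setT.
  have := eE 1 0 0 0 ler01 (lexx _) (lexx _) (lexx _).
  by rewrite P1 mule1 !mul0r !addr0 mulr1 => -[].
move=> p0 p1 p2 pc; have := eE _ _ _ _ p0 p1 p2 pc.
move=> /(congr1 (fun e => (L^-1)%:E * e)%E).
by rewrite muleA -!EFinM mulVf ?gt_eqF// mul1e LK mulKf ?gt_eqF.
Qed.

Lemma gc_integral_radial (A : R) : A = n.+2%:R / (2 * mu) ->
  (\int[P]_x (tsum x ^+ 2 / N%:R + (rad2 x - A) ^+ 2 / A)%:E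
   <= ((2 * a)^-1 + mu^-1)%:E)%E.
Proof.
move=> AE; have A0 : 0 < A by rewrite AE divr_gt0// mulr_gt0.
pose B (x : N.-tuple R) := tsum x ^+ 2 / N%:R + (rad2 x - A) ^+ 2 / A.
have B0 x : 0 <= B x.
  by rewrite addr_ge0// mulr_ge0 ?sqr_ge0// invr_ge0 ltW.
have mB : measurable_fun setT B.
  apply: measurable_funD.
    apply: measurable_funM => //; apply: measurable_funX; exact: measurable_tsum.
  apply: measurable_funM => //; apply: measurable_funX; apply: measurable_funB => //.
  exact: measurable_rad2.
have AV0 : 0 <= A^-1 by rewrite invr_ge0 ltW.
have := gc_integral_poly (ltW A0) (lexx 0) AV0 ler01.
have -> : (fun x => (gc_poly A 0 A^-1 1 x)%:E) =
    (fun x => ((B x)%:E + (gc_poly 0 2 0 0 x)%:E)%E).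
  apply/funext => x; rewrite -EFinD; congr EFin; rewrite /gc_poly /B.
  by move: (tsum x ^+ 2 / N%:R) => q; field; rewrite gt_eqF.
rewrite ge0_integralD//=.
- have IB0 : (0 <= \int[P]_x (B x)%:E)%E by apply: integral_ge0 => x _; rewrite lee_fin.
  rewrite gc_integral_poly// -[X in (X <= _)%E]/(\int[P]_x (B x)%:E)%E.
  move: IB0; case: (\int[P]_x (B x)%:E)%E => [r| |]// _.
  rewrite -EFinD => -[]; rewrite AE lee_fin => e.
  suff -> : r = (2 * a)^-1 + mu^-1 - (2 * mu * n.+2%:R)^-1.
    by rewrite lerBlDr lerDl invr_ge0 ltW// !mulr_gt0.
  move: e; rewrite !mul0r !addr0 add0r div1r; move: (2 * a)^-1 => w.
  move=> /(canRL (addrK _)) ->; rewrite -[n.+2%:R]natr1.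
  have n0 : 0 <= n%:R :> R by exact: ler0n.
  by field; apply/andP; split; apply: lt0r_neq0 => //; lra.
- by move=> x _; rewrite lee_fin.
- exact/measurable_EFinP.
- by move=> x _; rewrite lee_fin gc_poly_ge0.
- by apply/measurable_EFinP; exact: measurable_gc_poly.
Qed.

Lemma gc_mxact (Q : 'M[R]_N) (A : set (N.-tuple R)) : orth_fix1 Q -> measurable A ->
  P (mxact Q @^-1` A) = P A.
Proof.
move=> Qf mA; have [L L0 LE] := gc_integral.
have PE (B : set (N.-tuple R)) : measurable B ->
    (L%:E * P B = lebN (fun x => (\1_B x)%:E * (gc_weight beta mu J x)%:E))%E.
  move=> mB; rewrite -LE.
  - by rewrite integral_indic// setIT.
  - exact/measurable_EFinP.
  - by move=> x; rewrite lee_fin.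
have mQA : measurable (mxact Q @^-1` A).
  by rewrite -[X in measurable X]setTI; exact: measurable_mxact.
pose g (x : N.-tuple R) := ((\1_A x)%:E * (gc_weight beta mu J x)%:E)%E.
have mg : measurable_fun setT g.
  apply: emeasurable_funM; apply/measurable_EFinP => //.
  exact: measurable_gc_weight.
have g0 x : (0 <= g x)%E by rewrite mule_ge0// lee_fin gc_weight_ge0.
have /(congr1 (fun e => (L^-1)%:E * e)%E) : (L%:E * P (mxact Q @^-1` A) = L%:E * P A)%E.
  rewrite (PE _ mQA) (PE _ mA) -/g -(lebN_orth (proj1 Qf) mg g0).
  by congr lebN; apply/funext => x; rewrite /g gc_weight_mxact.
by rewrite !muleA -!EFinM mulVf ?gt_eqF// !mul1e.
Qed.

Lemma gc_rad2_eq0 : P [set x | rad2 x = 0] = 0%E.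
Proof.
have [L L0 LE] := gc_integral; set B := [set x | _].
have mB : measurable B.
  rewrite -[X in measurable X]setTI.
  exact: (@measurable_rad2 R N measurableT [set 0] (measurable_set1 _)).
have : (L%:E * P B = 0)%E.
  rewrite -[B]setIT -(integral_indic P measurableT mB) LE.
  - rewrite -integral_lebM.
    + rewrite (eq_integral ((fun x => (gc_weight beta mu J x)%:E) \_ B)).
        rewrite -integral_mkcond null_set_integral//; last exact: lebM_rad2_eq0.
        by apply: measurable_funTS; apply/measurable_EFinP; exact: measurable_gc_weight.
      by move=> x _; rewrite patchE indicE; case: ifP; rewrite ?mul1e ?mul0e.
    + apply: emeasurable_funM; apply/measurable_EFinP => //.
      exact: measurable_gc_weight.
    + by move=> x; rewrite mule_ge0// lee_fin gc_weight_ge0.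
  - exact/measurable_EFinP.
  - by move=> x; rewrite lee_fin.
by move=> /eqP; rewrite mule_eq0 eqe gt_eqF//= => /eqP.
Qed.

End weight.
End grand_canonical.
(** * The coupling *)

Section coupling.
Variables (R : realType) (n : nat) (J mu beta : R).
Hypotheses (mu0 : 0 < mu) (a0 : 0 < mu - beta * J / 2).
Local Notation N := n.+2.
Local Notation A := ((2 * mu)^-1 * N%:R).
Variables (Pgc Pmc : probability (N.-tuple R) R).
Hypotheses (GC : is_GC beta mu J Pgc) (MC : is_MC (2 * mu)^-1 Pmc).

Let mproj := @measurable_mc_proj R N A.

Lemma mc_proj_law : is_MC (2 * mu)^-1 (pushp Pgc mproj).
Proof.
have r0 : 0 <= (2 * mu)^-1 by rewrite invr_ge0 mulr_ge0// ltW.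
split.
  apply/eqP; rewrite eq_le probability_le1/=; last exact: measurable_mc_surface.
  have mB : measurable [set x : N.-tuple R | rad2 x = 0].
    rewrite -[X in measurable X]setTI.
    exact: (@measurable_rad2 R N measurableT [set 0] (measurable_set1 _)).
  have <- : Pgc (~` [set x | rad2 x = 0]) = 1%E.
    by rewrite probability_setC// (gc_rad2_eq0 mu0 a0 GC) sube0.
  apply: le_measure; rewrite ?inE.
  - exact: measurableC.
  - rewrite -[X in measurable X]setTI; apply: mproj => //.
    exact: measurable_mc_surface.
  - by move=> x /= /eqP x0; exact: mc_proj_surface.
move=> Q Qf B mB.
change (Pgc (mc_proj A @^-1` (mxact Q @^-1` B)) = Pgc (mc_proj A @^-1` B)).
have -> : mc_proj A @^-1` (mxact Q @^-1` B) = mxact Q @^-1` (mc_proj A @^-1` B).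
  by apply/seteqP; split => x /=; rewrite mc_proj_mxact.
apply: (gc_mxact mu0 a0 GC Qf).
by rewrite -[X in measurable X]setTI; exact: mproj.
Qed.

Lemma measurable_graph_mc_proj :
  measurable_fun setT (fun x : N.-tuple R => (x, mc_proj A x)).
Proof. exact: measurable_fun_pair. Qed.

Lemma w2sq_GC_MC : (w2sq Pgc Pmc <= (N%:R^-1 * ((2 * (mu - beta * J / 2))^-1 + mu^-1))%:E)%E.
Proof.
have A0 : 0 < A by rewrite mulr_gt0// invr_gt0 mulr_gt0.
pose G := pushp Pgc measurable_graph_mc_proj.
have Gc : is_coupling Pgc Pmc G.
  split=> B mB; first by [].
  exact: is_MC_unique mc_proj_law MC _ mB.
apply: (@le_trans _ _ (\int[G]_z (cost z)%:E)%E).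
  by apply: ereal_inf_lbound; exists G.
have mcost : measurable_fun setT (@cost R N).
  by apply: measurable_funM => //; exact: (measurable_sqd (f := fst) (g := snd)).
have cost0 z : 0 <= @cost R N z.
  by rewrite mulr_ge0 ?invr_ge0// sumr_ge0// => i _; exact: sqr_ge0.
rewrite ge0_integral_pushm; last 2 first.
- exact/measurable_EFinP.
- by move=> z; rewrite lee_fin.
pose B (x : N.-tuple R) := tsum x ^+ 2 / N%:R + (rad2 x - A) ^+ 2 / A.
have B0 x : 0 <= B x.
  by rewrite addr_ge0// mulr_ge0 ?sqr_ge0// invr_ge0 ltW.
have mB : measurable_fun setT B.
  apply: measurable_funD.
    apply: measurable_funM => //; apply: measurable_funX; exact: measurable_tsum.
  apply: measurable_funM => //; apply: measurable_funX; apply: measurable_funB => //.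
  exact: measurable_rad2.
apply: (@le_trans _ _ (\int[Pgc]_x (N%:R^-1 * B x)%:E)%E).
  apply: ge0_le_integral => //.
  - by move=> x _; rewrite lee_fin.
  - by apply/measurable_EFinP; exact: measurableT_comp mcost measurable_graph_mc_proj.
  - by apply/measurable_EFinP; exact: measurable_funM.
  - by move=> x _; rewrite lee_fin cost_mc_proj.
under eq_integral do rewrite EFinM.
rewrite ge0_integralZl_EFin ?invr_ge0//.
- by rewrite EFinM lee_pmul2l// (gc_integral_radial mu0 a0 GC)// mulrC.
- by move=> x _; rewrite lee_fin.
- exact/measurable_EFinP.
Qed.

End coupling.

Theorem theorem4p21 (R : realType) (J mu beta : R) (N : nat) :
  0 < J -> 0 < mu -> beta < 2 * mu / J -> (2 <= N)%N ->
  forall (Pgc Pmc : probability (N.-tuple R) R),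
    @is_GC R beta mu J N Pgc -> @is_MC R (2 * mu)^-1 N Pmc ->
    (@w2sq R N Pgc Pmc <= (N%:R^-1 * (2 * (mu - beta * J / 2))^-1
                      + N%:R^-1 * mu^-1)%:E)%E /\
    N%:R^-1 * (2 * (mu - beta * J / 2))^-1 + N%:R^-1 * mu^-1
    = N%:R^-1 * ((2 * mu)^-1 / (1 - (2 * mu)^-1 * beta * J) + 2 * (2 * mu)^-1).
Proof.
move=> J0 mu0 bJ; case: N => [|[|n]]// _ Pgc Pmc GC MC.
have a0 : 0 < mu - beta * J / 2.
  by move: bJ; rewrite ltr_pdivlMr// subr_gt0 ltr_pdivrMr// (mulrC mu).
rewrite -mulrDr; split; first exact: (w2sq_GC_MC mu0 a0 GC MC).
congr (_ * _); have m0 : mu != 0 by rewrite gt_eqF.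
have d0 : 2 * mu - beta * J != 0.
  rewrite (_ : _ - _ = 2 * (mu - beta * J / 2)); last by field.
  by rewrite gt_eqF// mulr_gt0.
have -> : 1 - (2 * mu)^-1 * beta * J = (2 * mu - beta * J) / (2 * mu) by field.
have -> : 2 * (mu - beta * J / 2) = 2 * mu - beta * J by field.
by field; rewrite m0 d0.
Qed.
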